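(* For every $\nu\in\mathbb R$, the exit problem of maximizing $E^x[\int_0^\tau X_te^{-\alpha t}\,dt]$ over $\tau\in\mathcal T$ has an optimal policy, and the optimal return $V(x;\nu)=\sup_{\tau\in\mathcal T}E^x[\int_0^\tau X_te^{-\alpha t}\,dt]$ is given by $$V(x;\nu)=\begin{cases}\dfrac{x}{\alpha}+\dfrac{\nu}{\alpha^2}+\dfrac{\sigma^2/\alpha}{\nu+\sqrt{\nu^2+2\alpha\sigma^2}}\exp\!\Big[\dfrac{-\nu-\sqrt{\nu^2+2\alpha\sigma^2}}{\sigma^2}\,(x-\xi(\nu))\Big], & x>\xi(\nu),\\[2mm] 0,&\text{otherwise,}\end{cases}$$ where $\xi(\nu)$ is the negative number $$\xi(\nu)=-\frac{\nu}{\alpha}-\frac{\sigma^2}{\nu+\sqrt{\nu^2+2\alpha\sigma^2}}=\frac{\sigma^2}{\nu-\sqrt{\nu^2+2\alpha\sigma^2}}.$$ Moreover, the optimal continuation region is $(\xi(\nu),\infty)$, i.e. $V(x;\nu)=E^x[\int_0^{\tau_D}X_te^{-\alpha t}\,dt]$ for all $x\in\mathbb R$ with $D=(\xi(\nu),\infty)$.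
   Context: $\alpha>0$ is the discount rate, $\sigma>0$ the volatility, $\nu\in\mathbb R$ the drift. $B_t$ is a standard one-dimensional Brownian motion on a filtered probability space, $X_t=X_0+\nu t+\sigma B_t$, $E^x$ is expectation given $X_0=x\in\mathbb R$, and $\mathcal T$ is the set of all stopping times with values in $[0,\infty]$. For $D\subset\mathbb R$, $\tau_D=\inf\{t>0:X_t\notin D\}$. *)

(* Defs.v *)
From HB Require Import structures.
From mathcomp Require Export all_boot all_order all_algebra.
From mathcomp Require Export all_classical all_reals all_analysis.

Set Implicit Arguments.
Unset Strict Implicit.
Unset Printing Implicit Defensive.

Import Order.TTheory GRing.Theory Num.Theory.
Import numFieldNormedType.Exports.

Local Open Scope classical_set_scope.
Local Open Scope ring_scope.

(* Continuous time is [0, +oo[, encoded as the nonnegative elements of R;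
   filtrations and processes are indexed by all of R, and their values at
   negative indices are irrelevant. *)

Section continuous_time.
Context {R : realType} {d : measure_display} {Omega : measurableType d}.
Implicit Types (F : R -> set (set Omega)) (X B : R -> Omega -> R).

(* The usual conditions (right-continuity, completeness) are not assumed. *)
Record is_filtration F : Prop := IsFiltration {
  filtration_sigma_algebra :
    forall t : R, 0 <= t -> sigma_algebra [set: Omega] (F t) ;
  filtration_measurable : forall t : R, 0 <= t -> F t `<=` measurable ;
  filtration_monotone : forall s t : R, 0 <= s -> s <= t -> F s `<=` F t }.

(* Standard Brownian motion relative to F. The case s = t is excluded from the
   increment law because [normal_prob 0 0] is not the Dirac mass at 0. *)
Record is_brownian_motion (P : probability Omega R) F B : Prop :=
  IsBrownianMotion {
  brownian_adapted : forall t : R, 0 <= t ->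
    forall U : set R, measurable U -> F t (B t @^-1` U) ;
  brownian_start : {ae P, forall w, B 0 w = 0} ;
  brownian_continuous : forall w,
    {within `[0, +oo[%classic, continuous (fun t => B t w)} ;
  brownian_increment_law : forall s t : R, 0 <= s -> s < t ->
    forall U : set R, measurable U ->
    P ((fun w => B t w - B s w) @^-1` U) =
      normal_prob 0 (Num.sqrt (t - s)) U ;
  brownian_increment_indep : forall s t : R, 0 <= s -> s < t ->
    forall (A : set Omega) (U : set R), F s A -> measurable U ->
    P (A `&` (fun w => B t w - B s w) @^-1` U) =
      (P A * P ((fun w => (B t w - B s w)%R) @^-1` U))%E }.

Definition stopping_times F : set (Omega -> \bar R) :=
  [set tau | (forall w, (0 <= tau w)%E) /\
             (forall t : R, 0 <= t -> F t [set w | (tau w <= t%:E)%E])].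

(* The infimum of the empty set is +oo. *)
Definition exit_time X (D : set R) (w : Omega) : \bar R :=
  ereal_inf [set t%:E | t in [set t : R | 0 < t /\ ~ D (X t w)]].

Definition drifted_brownian_motion (nu sigma : R) B (x : R) : R -> Omega -> R :=
  fun t w => x + nu * t + sigma * B t w.

Definition discounted_return (alpha : R) (P : probability Omega R) X
    (tau : Omega -> \bar R) : \bar R :=
  ('E_P[fun w => (\int[lebesgue_measure]_(t in
          [set t : R | 0 <= t /\ (t%:E <= tau w)%E])
            (X t w * expR (- (alpha * t))))%R])%E.

Definition optimal_return (alpha : R) (P : probability Omega R) F X : \bar R :=
  ereal_sup [set discounted_return alpha P X tau | tau in stopping_times F].

End continuous_time.

Arguments brownian_continuous {R d Omega P F B} _ w.

(* Main.v *)
From HB Require Import structures.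
Require Import Defs.
Import Order.TTheory GRing.Theory Num.Theory.
Import numFieldNormedType.Exports.
From mathcomp Require Import measurable_realfun ring lra.

(** Let [v y = y / alpha + nu / alpha ^+ 2 + C * expR (lam * y)] be the formula
    of the continuation region, extended to every starting point. Here [lam] is
    the negative root of [lam * nu + lam ^+ 2 * sigma ^+ 2 / 2 = alpha], so that
    [v] solves [(sigma ^+ 2 / 2) v'' + nu v' - alpha v + y = 0] on the whole
    line, and [C] and the boundary [xi] are fixed by smooth fit,
    [v xi = v' xi = 0]. Smooth fit gives more than continuity of the value:
    with [u = lam * (y - xi)] it says that [v] is a positive multiple of
    [expR u - 1 - u] ([continuation_value_smooth_fit]), hence that [v] is
    nonnegative on the whole line, below [xi] as well.

    The two halves of the theorem rest on Dynkin's formula: for a bounded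
    stopping rule, the expected gain equals [v x] minus the mean of
    [expR (- alpha tau) v (X_tau)].

    - Since [v] is nonnegative, no rule earns more than [v x]
      ([area_le_continuation_value]). For a start [x <= xi] a better bound is
      free: a given rule earns more from [xi] than from [x], the paths being
      translates of each other ([discounted_return_mono]), and from [xi] it
      earns at most [v xi = 0]. Thus [v] on the right of [xi] and [0] on the left
      bound the return, and the value function, which is not smooth at [xi],
      never has to be shown to define a supermartingale.

    - Stopping at the entrance into the half-line below [xi] loses nothing:
      there [v (X_tau) = v xi = 0], and the paths that survive until [T] keep a
      value of linear size, which the discounting kills
      ([continuation_value_le_area]). From [x <= xi] one stops at once.

    Dynkin's formula is obtained without stochastic integration. On a time step
    [s, t] and an event of the past, it follows from two facts about the
    Gaussian increments: [X_t - nu t] and [expR (lam X_t - alpha t)] are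
    martingales, and the discounted integral of the affine function
    [E X_r] is explicit ([running_gain]). Summing over the steps of a grid
    gives it for bounded grid-valued times ([grid_gain]).
    A general rule is rounded up to a grid of mesh [1 / (n + 1)]. By Fubini the
    expected gain is the integral of [X_t expR (- alpha t)] over the region of
    the product space below the graph of the rule
    ([discounted_return_region]); these regions stabilize pointwise as the mesh
    shrinks, so dominated convergence passes to the limit
    ([Rintegral_region_cvg]). For the second half the means of the values at the
    rounded times must converge too: rounding overshoots the boundary to where
    [v] grows exponentially, and uniform integrability comes from a second
    moment bound on a bounded horizon ([mean_truncation]).

    Rounding up only uses that the events [tau < t] are past at time [t], which
    is why the exit time of the open half-line is covered although it need not
    be a stopping time of a filtration that is not right-continuous; an optimal
    stopping time is the first entrance at a time [t >= 0]. *)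

Set Implicit Arguments.
Unset Strict Implicit.
Unset Printing Implicit Defensive.

Local Open Scope classical_set_scope.
Local Open Scope ring_scope.

(** * Elementary bounds and limits *)

Section elementary_bounds.
Context {R : realType}.

Lemma ler_norm_expR (e y : R) : 0 < e ->
  `|y| <= (expR (e * y) + expR (- e * y)) / e.
Proof.
move=> e0; rewrite ler_pdivlMr//.
have -> : `|y| * e = `|e * y| by rewrite normrM (gtr0_norm e0) mulrC.
have h1 := expR_ge1Dx (e * y); have h2 := expR_ge1Dx (- (e * y)).
have := expR_gt0 (e * y); have := expR_gt0 (- (e * y)); rewrite mulNr.
by case: (lerP 0 (e * y)) => ey; [rewrite ger0_norm|rewrite ltr0_norm]; lra.
Qed.

(** For [a] of the sign of [m] the left side is of first order in [a] and the
    right side of second order. *)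
Lemma eq0_of_expR_bound (m p c : R) : 0 <= p <= 1 -> 0 <= c ->
  (forall a, a * m <= p * (expR (a ^+ 2 * c) - 1)) -> m = 0.
Proof.
move=> /andP[p0 p1] c0 H; apply/eqP; apply: contraT => m0.
have m2 : 0 < m ^+ 2 by rewrite exprn_even_gt0.
(* Take [a = m / k]: the term [m ^+ 2] in [k] keeps [u = a ^+ 2 * c] below 1/2,
   where [expR u - 1 <= 2 * u], and [k > 2 * c] makes the linear term win. *)
pose k := 2 * c + 1 + m ^+ 2.
have k0 : 0 < k by rewrite /k; lra.
pose u := (m / k) ^+ 2 * c.
have u0 : 0 <= u by rewrite mulr_ge0// sqr_ge0.
have ku : k ^+ 2 * u = m ^+ 2 * c by rewrite /u; field; rewrite gt_eqF.
have uh : u <= 1 / 2.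
  rewrite -(ler_pM2l (exprn_gt0 2 k0)) ku /k.
  have := mulr_ge0 c0 (ltW m2); nra.
have eu : expR u - 1 <= 2 * u.
  have := expR_ge1Dx (- u); have := expR_gt0 u; have := expRxMexpNx_1 u.
  nra.
have := H (m / k); rewrite -/u => Hk.
have : m / k * m <= 2 * u.
  apply: (le_trans Hk); apply: (le_trans _ eu); rewrite ler_piMl//.
  by rewrite subr_ge0 -expR0 ler_expR.
rewrite -(ler_pM2l (exprn_gt0 2 k0)) [X in _ <= X]mulrCA ku.
have -> : k ^+ 2 * (m / k * m) = k * m ^+ 2 by field; rewrite gt_eqF.
by rewrite /k; nra.
Qed.

Lemma ler_min_sqr (z K : R) : 0 < K -> 0 <= z -> z <= Num.min z K + z ^+ 2 / K.
Proof.
move=> K0 z0; have [zK|Kz] := leP z K.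
  by rewrite lerDl divr_ge0 ?sqr_ge0// ltW.
apply: (@le_trans _ _ (z ^+ 2 / K)); last by rewrite lerDr ltW.
by rewrite ler_pdivlMr// expr2 ler_pM2l// ?ltW// (lt_trans K0).
Qed.

Lemma within_continuous_cvg_seq (A : set R) (f : R -> R)
    (u : R^nat) (l : R) :
  {within A, continuous f} -> (forall n, A (u n)) -> A l ->
  u @ \oo --> l -> f (u n) @[n --> \oo] --> f l.
Proof.
move=> /subspace_continuousP cf Au Al ul; apply: cvg_comp (cf _ Al).
move=> U hU.
apply: (@filterS _ \oo _ (fun n => A (u n) -> U (u n))) (ul _ hU) => n.
exact.
Qed.

End elementary_bounds.

(** * Gaussian increments independent of the past *)

Section normal_mgf.
Context {R : realType}.
Local Notation mu := (@lebesgue_measure R).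

(** The normal law being defined by its density on sets only, integrating
    against it goes through its Radon-Nikodym derivative. *)
Lemma ge0_integral_normal_prob (m s : R) (f : R -> \bar R) :
  measurable_fun setT f -> (forall x, 0 <= f x)%E ->
  (\int[normal_prob m s]_x f x = \int[mu]_x (f x * (normal_pdf m s x)%:E))%E.
Proof.
move=> mf f0.
have dom := normal_prob_dominates m s.
rewrite -(Radon_Nikodym_SigmaFinite.change_of_variables dom)//=.
apply: ae_eq_integral => //.
- apply: emeasurable_funM => //.
  exact: measurable_int (Radon_Nikodym_SigmaFinite.f_integrable dom).
- apply: emeasurable_funM => //.
  by apply/measurable_EFinP; exact: measurable_normal_pdf.
- apply: ae_eqe_mul2l.
  apply: integral_ae_eq => //.
  + exact: (Radon_Nikodym_SigmaFinite.f_integrable dom).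
  + by apply/measurable_EFinP; exact: measurable_normal_pdf.
  + by move=> E _ mE; rewrite -Radon_Nikodym_SigmaFinite.f_integral.
Qed.

(** Completing the square turns the exponentially tilted centred density into
    the density with mean [a * s ^+ 2], whose total mass is one. *)
Lemma normal_prob_mgf (a s : R) : s != 0 ->
  (\int[normal_prob 0 s]_z (expR (a * z))%:E =
   (expR (a ^+ 2 * s ^+ 2 / 2))%:E)%E.
Proof.
move=> s0; rewrite ge0_integral_normal_prob//; last first.
  by apply/measurable_EFinP; apply: measurableT_comp.
transitivity (\int[mu]_z ((expR (a ^+ 2 * s ^+ 2 / 2))%:E *
    (normal_pdf (a * s ^+ 2) s z)%:E))%E.
  apply: eq_integral => z _; rewrite -!EFinM !normal_pdfE//; congr (_%:E).
  rewrite mulrCA [RHS]mulrCA; congr (_ * _).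
  rewrite /normal_fun -!expRD; congr expR.
  by field.
rewrite ge0_integralZl//; last 2 first.
- by apply/measurable_EFinP; exact: measurable_normal_pdf.
- by move=> z _; rewrite lee_fin normal_pdf_ge0.
by rewrite integral_normal_pdf mule1.
Qed.

End normal_mgf.

Section independent_increments.
Context {R : realType} {d : measure_display} {Omega : measurableType d}.
Variables (P : probability Omega R) (F : R -> set (set Omega)) (B : R -> Omega -> R).
Hypotheses (hF : is_filtration F) (hB : is_brownian_motion P F B).

Lemma brownian_measurable t : 0 <= t -> measurable_fun setT (B t).
Proof.
move=> t0 _ U mU; rewrite setTI; apply: (filtration_measurable hF t0).
exact: (brownian_adapted hB).
Qed.

(** Functions measurable for the past are independent of the next increment;
    only the product of their expectations with that of an exponential of the
    increment is ever needed. *)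
Lemma ge0_integral_past_increment (s t b : R) (G : Omega -> R) :
  0 <= s -> s < t -> (forall w, 0 <= G w) ->
  (forall U : set R, measurable U -> F s (G @^-1` U)) ->
  (\int[P]_w (G w * expR (b * (B t w - B s w)))%:E =
   \int[P]_w (G w)%:E * (expR (b ^+ 2 * (t - s) / 2))%:E)%E.
Proof.
move=> s0 st G0 FG.
have mBs := brownian_measurable s0.
have mBt := brownian_measurable (le_trans s0 (ltW st)).
have mG : measurable_fun setT G.
  by move=> _ U mU; rewrite setTI; exact: (filtration_measurable hF s0 (FG U mU)).
pose D w := B t w - B s w.
have mD : measurable_fun setT D by exact: measurable_funB.
have ts0 : Num.sqrt (t - s) != 0 by rewrite gt_eqF// sqrtr_gt0 subr_gt0.
pose T := measurableTypeR R.
have mGD : measurable_fun setT (fun w => (G w, D w) : T * T).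
  exact/measurable_fun_pair.
pose mGm := isMeasurableFun.Build _ _ Omega T G mG.
pose G' : {mfun Omega >-> T} := HB.pack G mGm.
pose GDm := isMeasurableFun.Build _ _ Omega (T * T)%type _ mGD.
pose GD : {mfun Omega >-> (T * T)%type} := HB.pack (fun w => (G w, D w)) GDm.
pose m1 : probability T R := distribution P G'.
pose N : probability T R := normal_prob 0 (Num.sqrt (t - s)).
pose f (z : T * T) : \bar R := (`|z.1| * expR (b * z.2))%:E.
have mf : measurable_fun setT f.
  apply/measurable_EFinP; apply: measurable_funM.
    by apply: measurableT_comp => //; exact: measurable_fst.
  by apply: measurableT_comp => //; apply: measurable_funM.
have f0 z : (0 <= f z)%E by rewrite lee_fin mulr_ge0 ?expR_ge0.
transitivity (\int[distribution P GD]_z f z)%E.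
  rewrite ge0_integral_pushforward//=.
  by apply: eq_integral => w _; rewrite /f/= ger0_norm.
transitivity (\int[m1 \x N]_z f z)%E.
  apply: eq_measure_integral => /= X mX _; symmetry.
  apply: product_measure_unique => // U V mU mV.
  rewrite [LHS](_ : _ = P (G @^-1` U `&` D @^-1` V)); last by [].
  rewrite (brownian_increment_indep hB s0 st (FG U mU) mV).
  by rewrite (brownian_increment_law hB s0 st mV).
rewrite fubini_tonelli1// /fubini_F.
pose M := expR (b ^+ 2 * (t - s) / 2).
have mabs : measurable_fun setT (fun g : T => `|g|%:E).
  by apply/measurable_EFinP; exact: normr_measurable.
have inner (g : T) : (\int[N]_y f (g, y) = `|g|%:E * M%:E)%E.
  transitivity (\int[N]_y (`|g|%:E * (expR (b * y))%:E))%E.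
    by apply: eq_integral => y _; rewrite /f/= EFinM.
  rewrite ge0_integralZl//; last first.
    by apply/measurable_EFinP; apply: measurableT_comp.
  by rewrite normal_prob_mgf// sqr_sqrtr// subr_ge0 ltW.
transitivity (\int[m1]_g (`|g|%:E * M%:E))%E; first exact: eq_integral.
rewrite ge0_integralZr//; last by rewrite lee_fin expR_ge0.
congr (_ * _)%E; rewrite ge0_integral_pushforward//=.
by apply: eq_integral => w _ /=; rewrite ger0_norm.
Qed.

End independent_increments.

(** * Exponential and linear martingales *)

Section exponential_martingale.
Context {R : realType} {d : measure_display} {Omega : measurableType d}.
Variables (P : probability Omega R) (F : R -> set (set Omega)) (B : R -> Omega -> R).
Hypotheses (hF : is_filtration F) (hB : is_brownian_motion P F B).
Local Notation past t := (g_sigma_algebraType (F t)).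

(** Presenting the past as a measurable space turns adaptedness of a
    composite expression into ordinary measurability. *)
Lemma past_measurableE t (A : set Omega) : 0 <= t ->
  measurable (A : set (past t)) = F t A.
Proof.
move=> t0; rewrite /measurable/= sigma_algebra_id//.
exact: filtration_sigma_algebra.
Qed.

Lemma brownian_past_measurable s t : 0 <= s -> s <= t ->
  measurable_fun setT (B s : past t -> R).
Proof.
move=> s0 st _ U mU; rewrite setTI past_measurableE ?(le_trans s0)//.
apply: (filtration_monotone hF s0 st).
exact: (brownian_adapted hB).
Qed.

Variables (nu sigma x : R).
Local Notation X := (drifted_brownian_motion nu sigma B x).

Lemma drifted_measurable t : 0 <= t -> measurable_fun setT (X t).
Proof.
move=> t0; apply: measurable_funD => //; apply: measurable_funM => //.
exact: (brownian_measurable hF hB).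
Qed.

Lemma drifted_past_measurable s t : 0 <= s -> s <= t ->
  measurable_fun setT (X s : past t -> R).
Proof.
move=> s0 st; apply: measurable_funD => //; apply: measurable_funM => //.
exact: brownian_past_measurable.
Qed.

(** The Laplace exponent of the drifted motion: the mean of [expR (a * X t)] is
    [expR (a * x + exponent a * t)]. *)
Definition exponent (a : R) := a * nu + a ^+ 2 * sigma ^+ 2 / 2.

Lemma exponential_martingale (a s t : R) (A : set Omega) :
  0 <= s -> s <= t -> F s A ->
  (\int[P]_(w in A) (expR (a * X t w))%:E =
   \int[P]_(w in A) (expR (a * X s w))%:E * (expR (exponent a * (t - s)))%:E)%E.
Proof.
move=> s0; rewrite le_eqVlt => /predU1P[<- _|st FA].
  by rewrite subrr mulr0 expR0 mule1.
have mA : measurable A := filtration_measurable hF s0 FA.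
have mXs := drifted_measurable s0.
pose G w := \1_A w * expR (a * X s w) : R.
have FG U : measurable U -> F s (G @^-1` U).
  move=> mU; rewrite -past_measurableE// -[X in measurable X]setTI.
  suff : measurable_fun setT (G : past s -> R) by apply.
  apply: measurable_funM.
    by apply: measurable_indic; rewrite past_measurableE.
  apply: measurableT_comp => //; apply: measurable_funM => //.
  exact: drifted_past_measurable.
have G0 w : 0 <= G w by rewrite mulr_ge0 ?expR_ge0.
have indE (f : Omega -> R) :
    (\int[P]_(w in A) (f w)%:E = \int[P]_w (\1_A w * f w)%:E)%E.
  rewrite integral_mkcond; apply: eq_integral => w _.
  by rewrite patchE indicE; case: ifPn => _; rewrite ?mul1r ?mul0r.
have mXt := drifted_measurable (le_trans s0 (ltW st)).
transitivity (\int[P]_w ((expR (a * nu * (t - s)))%:E *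
    (G w * expR (a * sigma * (B t w - B s w)))%:E))%E.
  rewrite indE; apply: eq_integral => w _; rewrite -EFinM; congr (_%:E).
  have -> : expR (a * X t w) = expR (a * nu * (t - s)) *
      (expR (a * X s w) * expR (a * sigma * (B t w - B s w))).
    by rewrite -!expRD; congr expR; rewrite /drifted_brownian_motion; ring.
  by rewrite /G; ring.
rewrite ge0_integralZl//; last 2 first.
- apply/measurable_EFinP; apply: measurable_funM.
    apply: measurable_funM; first exact: measurable_indic.
    by apply: measurableT_comp => //; exact: measurable_funM.
  apply: measurableT_comp => //; apply: measurable_funM => //.
  by apply: measurable_funB; apply: (brownian_measurable hF hB) => //;
    rewrite (le_trans s0)// ltW.
- by move=> w _; rewrite lee_fin mulr_ge0// expR_ge0.
rewrite (ge0_integral_past_increment hF hB)// -indE muleCA; congr (_ * _)%E.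
rewrite -EFinM -expRD; congr (expR _)%:E.
by rewrite /exponent; field.
Qed.

Lemma exponential_moment (a t : R) : 0 <= t ->
  (\int[P]_w (expR (a * X t w))%:E = (expR (a * x + exponent a * t))%:E)%E.
Proof.
move=> t0; have F0T : F 0 setT.
  by rewrite -past_measurableE//; exact: measurableT.
rewrite (exponential_martingale _ (lexx 0) t0 F0T) subr0.
have -> : (\int[P]_w (expR (a * X 0 w))%:E = (expR (a * x))%:E)%E.
  transitivity (\int[P]_w (cst (expR (a * x))%:E w))%E; last first.
    by rewrite integral_cst//= [X in (_ * X)%E]probability_setT mule1.
  apply: ae_eq_integral => //.
    apply/measurable_EFinP; apply: measurableT_comp => //.
    by apply: measurable_funM => //; exact: drifted_measurable.
  have := brownian_start hB; apply: filterS => w B0 _.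
  by rewrite /drifted_brownian_motion B0 !mulr0 !addr0.
by rewrite -EFinM -expRD.
Qed.

Lemma integrable_expR (a t : R) : 0 <= t ->
  P.-integrable setT (EFin \o (fun w => expR (a * X t w))).
Proof.
move=> t0; apply/integrableP; split.
  apply/measurable_EFinP; apply: measurableT_comp => //.
  by apply: measurable_funM => //; exact: drifted_measurable.
under eq_integral do rewrite /= ger0_norm ?expR_ge0//.
by rewrite exponential_moment// ltry.
Qed.

Lemma integrable_drifted (t : R) : 0 <= t -> P.-integrable setT (EFin \o X t).
Proof.
move=> t0.
have := integrableD measurableT (integrable_expR 1 t0) (integrable_expR (-1) t0).
apply: le_integrable => //.
  by apply/measurable_EFinP; exact: drifted_measurable.
move=> w _ /=; rewrite lee_fin [leRHS]ger0_norm ?addr_ge0 ?expR_ge0//.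
by have := ler_norm_expR (X t w) ltr01; rewrite divr1.
Qed.

Lemma increment_exponential_moment (a s t : R) (A : set Omega) :
  0 <= s -> s < t -> F s A ->
  (\int[P]_(w in A) (expR (a * (B t w - B s w)))%:E =
   (fine (P A) * expR (a ^+ 2 * ((t - s) / 2)))%:E)%E.
Proof.
move=> s0 st FA; have mA : measurable A := filtration_measurable hF s0 FA.
rewrite integral_mkcond.
transitivity (\int[P]_w (\1_A w * expR (a * (B t w - B s w)))%:E)%E.
  apply: eq_integral => w _.
  by rewrite patchE indicE; case: ifPn => _; rewrite ?mul1r ?mul0r.
rewrite (ge0_integral_past_increment hF hB)//; last first.
  move=> U mU; rewrite -past_measurableE// -[X in measurable X]setTI.
  suff : measurable_fun setT (\1_A : past s -> R) by apply.
  by apply: measurable_indic; rewrite past_measurableE.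
have -> : (\int[P]_w (\1_A w)%:E = (fine (P A))%:E)%E.
  by rewrite integral_indic// setIT fineK// fin_num_measure.
by rewrite -EFinM mulrA.
Qed.

Lemma integrable_increment_expR (a s t : R) (A : set Omega) :
  0 <= s -> s < t -> F s A ->
  P.-integrable A (EFin \o (fun w => expR (a * (B t w - B s w)))).
Proof.
move=> s0 st FA; have t0 : 0 <= t := le_trans s0 (ltW st).
apply/integrableP; split.
  apply/measurable_EFinP/measurable_funTS; apply: measurableT_comp => //.
  apply: measurable_funM => //.
  by apply: measurable_funB; apply: (brownian_measurable hF hB).
under eq_integral do rewrite /= ger0_norm ?expR_ge0//.
by rewrite increment_exponential_moment// ltry.
Qed.

Lemma integrable_increment (s t : R) (A : set Omega) :
  0 <= s -> s < t -> F s A ->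
  P.-integrable A (EFin \o (fun w => B t w - B s w)).
Proof.
move=> s0 st FA; have mA : measurable A := filtration_measurable hF s0 FA.
have t0 : 0 <= t := le_trans s0 (ltW st).
have := integrableD mA (integrable_increment_expR 1 s0 st FA)
  (integrable_increment_expR (-1) s0 st FA).
apply: le_integrable => //.
  apply/measurable_EFinP/measurable_funTS.
  by apply: measurable_funB; apply: (brownian_measurable hF hB).
move=> w _ /=; rewrite lee_fin [leRHS]ger0_norm ?addr_ge0 ?expR_ge0//.
by have := ler_norm_expR (B t w - B s w) ltr01; rewrite divr1.
Qed.

(** The mean of an increment is read off its exponential moments: the convexity
    bound [1 + u <= expR u] at the exponents [a] and [- a], divided by [a],
    leaves nothing else in the limit [a = 0]. *)
Lemma increment_mean0 (s t : R) (A : set Omega) : 0 <= s -> s < t -> F s A ->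
  \int[P]_(w in A) (B t w - B s w) = 0.
Proof.
move=> s0 st FA; have mA : measurable A := filtration_measurable hF s0 FA.
pose D w := B t w - B s w.
have iD := integrable_increment s0 st FA.
have ieD a := integrable_increment_expR a s0 st FA.
have i1 : P.-integrable A (EFin \o (fun=> 1)).
  apply: (integrableS measurableT mA (@subsetT _ _)).
  exact: finite_measure_integrable_cst.
apply: (@eq0_of_expR_bound _ _ (fine (P A)) ((t - s) / 2)).
- by rewrite fine_ge0//= -lee_fin fineK ?fin_num_measure// probability_le1.
- by rewrite divr_ge0// subr_ge0 ltW.
- move=> a; rewrite -RintegralZl//.
  have -> : fine (P A) * (expR (a ^+ 2 * ((t - s) / 2)) - 1) =
      \int[P]_(w in A) (expR (a * D w) - 1).
    rewrite RintegralB//.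
    by rewrite Rintegral_cst// mul1r mulrBr mulr1 /Rintegral
      increment_exponential_moment.
  apply: le_Rintegral => //.
  + exact: (integrableZl mA a iD).
  + exact: (integrableB mA (ieD a) i1).
  + by move=> w _; have := expR_ge1Dx (a * D w); rewrite /D; lra.
Qed.

Lemma drifted_mean (s t : R) (A : set Omega) : 0 <= s -> s <= t -> F s A ->
  \int[P]_(w in A) X t w =
  \int[P]_(w in A) X s w + nu * (t - s) * fine (P A).
Proof.
move=> s0; rewrite le_eqVlt => /predU1P[<- _|st FA].
  by rewrite subrr mulr0 mul0r addr0.
have t0 : 0 <= t := le_trans s0 (ltW st).
have mA : measurable A := filtration_measurable hF s0 FA.
have iX r : 0 <= r -> P.-integrable A (EFin \o X r).
  by move=> r0; apply: integrableS (integrable_drifted r0).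
have ic c : P.-integrable A (EFin \o (fun=> c)).
  apply: (integrableS measurableT mA (@subsetT _ _)).
  exact: finite_measure_integrable_cst.
transitivity (\int[P]_(w in A) (X s w + nu * (t - s) + sigma * (B t w - B s w))).
  apply: eq_Rintegral => w _; rewrite /drifted_brownian_motion; ring.
have iD := integrable_increment s0 st FA.
rewrite RintegralD//; last 2 first.
- exact: (integrableD mA (iX _ s0) (ic _)).
- exact: (integrableZl mA sigma iD).
rewrite RintegralD//; last exact: iX.
rewrite [X in _ + X = _](@RintegralZl _ _ _ P A _ sigma mA iD).
rewrite (increment_mean0 s0 st FA) mulr0 addr0 Rintegral_cst//.
Qed.
End exponential_martingale.

(** * The expected gain as an integral over a product space *)

Section joint_measurability.
Context {R : realType} {d : measure_display} {Omega : measurableType d}.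
Variable Z : R -> Omega -> R.
Hypotheses (mZ : forall t, 0 <= t -> measurable_fun setT (Z t)).
Hypotheses (cZ : forall w, {within `[0, +oo[%classic, continuous (Z ^~ w)}).

(** Left rounding of the time to the mesh [1 / (n + 1)] makes a process
    jointly measurable, and path continuity lets the mesh go to zero. *)
Lemma joint_measurable :
  measurable_fun setT (fun z : Omega * R => Z (Num.max 0 z.2) z.1).
Proof.
pose q n (t : R) : nat := Num.truncn (Num.max 0 t * n.+1%:R).
have t0 n (t : R) : 0 <= Num.max 0 t * n.+1%:R.
  by rewrite mulr_ge0// le_max lexx.
pose Zn n (z : Omega * R) := Z ((q n z.2)%:R / n.+1%:R) z.1.
apply: (@measurable_fun_cvg _ _ _ setT Zn).
- move=> n _ U mU; rewrite setTI.
  rewrite [X in measurable X](_ : _ = \bigcup_k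
     ((Z (k%:R / n.+1%:R) @^-1` U) `*`
      [set t | k%:R <= Num.max 0 t * n.+1%:R < k.+1%:R])).
    apply: bigcupT_measurable => k; apply: measurableX.
      by rewrite -[X in measurable X]setTI; apply: mZ => //; rewrite divr_ge0.
    rewrite -[X in measurable X]setTI.
    have mg : measurable_fun setT (fun t : R => Num.max 0 t * n.+1%:R).
      by apply: measurable_funM => //; exact: measurable_maxr.
    have := mg measurableT `[k%:R, k.+1%:R[%classic (measurable_itv _).
    by congr measurable; congr (_ `&` _); apply/seteqP; split => t /=; rewrite in_itv.
  apply/seteqP; split => [[w t]/= UZ|[w t]/= [k _ [/= UZ kt]]].
    by exists (q n t) => //; split => //=; exact: truncn_itv.
  by rewrite /Zn/= /q (truncn_def kt).
- move=> [w t] _ /=.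
  have qt : (q n t)%:R / n.+1%:R @[n --> \oo] --> (Num.max 0 t : R).
    apply: (@squeeze_cvgr _ _ _ _ (fun n => Num.max 0 t - n.+1%:R^-1)
      (fun=> Num.max 0 t)); last 2 first.
    + rewrite -[X in _ --> X]subr0; apply: cvgB; first exact: cvg_cst.
      exact: cvg_harmonic.
    + exact: cvg_cst.
    near=> n; have /andP[h1 h2] := truncn_itv (t0 n t).
    apply/andP; split.
      rewrite lerBlDr -[X in _ + X]mul1r -mulrDl ler_pdivlMr//.
      by rewrite natr1 ltW.
    by rewrite ler_pdivrMr.
  have m0 : (0 : R) <= Num.max 0 t by rewrite le_max lexx.
  have q0 n : `[0, +oo[%classic ((q n t)%:R / n.+1%:R : R).
    by rewrite /= in_itv/= andbT divr_ge0.
  have max0 : `[0, +oo[%classic (Num.max 0 t : R) by rewrite /= in_itv/= andbT.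
  exact: (within_continuous_cvg_seq (@cZ w) q0 max0 qt).
Unshelve. all: by end_near.
Qed.

End joint_measurability.

Section discounted_gain.
Context {R : realType} {d : measure_display} {Omega : measurableType d}.
Variables (P : probability Omega R) (F : R -> set (set Omega)) (B : R -> Omega -> R).
Hypotheses (hF : is_filtration F) (hB : is_brownian_motion P F B).
Variables (alpha nu sigma : R).
Hypotheses (alpha0 : 0 < alpha).
Local Notation mu := (@lebesgue_measure R).
Local Notation TR := (measurableTypeR R).

Section fixed_start.
Variable x : R.
Local Notation X := (drifted_brownian_motion nu sigma B x).

Lemma drifted_continuous w : {within `[0, +oo[%classic, continuous (X ^~ w)}.
Proof.
have /subspace_continuousP cB := brownian_continuous hB w.
apply/subspace_continuousP => t t0; apply: cvgD.
  apply: cvgD; first exact: cvg_cst.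
  by apply: cvgM; [exact: cvg_cst|exact: cvg_within].
by apply: cvgM; [exact: cvg_cst|exact: cB].
Qed.

(** The rate is chosen so that the exponential moments of orders plus and minus
    [gain_rate] grow at most like [expR (alpha * t / 2)], slower than the
    discounting. *)
Definition gain_rate := alpha / (2 * `|nu| + sigma ^+ 2 + alpha).

Lemma gain_rate_gt0 : 0 < gain_rate.
Proof.
rewrite divr_gt0// ltr_wpDl// addr_ge0 ?sqr_ge0// mulr_ge0//.
Qed.

Lemma exponent_gain_rate b : `|b| <= gain_rate -> exponent nu sigma b <= alpha / 2.
Proof.
have e0 := gain_rate_gt0; set e := gain_rate in e0 *.
have den0 : 0 < 2 * `|nu| + sigma ^+ 2 + alpha.
  by rewrite ltr_wpDl// addr_ge0 ?sqr_ge0// mulr_ge0.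
have ee : e * (2 * `|nu| + sigma ^+ 2 + alpha) = alpha.
  by rewrite /e /gain_rate divfK// gt_eqF.
have e1 : e <= 1.
  rewrite /e ler_pdivrMr// mul1r lerDr addr_ge0 ?sqr_ge0// mulr_ge0//.
move=> be; rewrite /exponent.
have h1 : b * nu <= e * `|nu|.
  by rewrite (le_trans (ler_norm _))// normrM ler_wpM2r.
have h2 : b ^+ 2 <= e.
  rewrite -real_normK ?num_real// expr2 (@le_trans _ _ (e * 1))//; last by rewrite mulr1.
  by rewrite ler_pM// (le_trans be).
have s0 := sqr_ge0 sigma; have := mulr_ge0 (ltW e0) (ltW alpha0).
have : b ^+ 2 * sigma ^+ 2 <= e * sigma ^+ 2 by rewrite ler_wpM2r.
nra.
Qed.

Definition gain_bound :=
  (expR (gain_rate * x) + expR (- gain_rate * x)) / gain_rate.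

(** The absolute value is dominated by the two exponentials of rate
    [gain_rate]. *)
Lemma mean_norm_drifted t : 0 <= t ->
  (\int[P]_w `|X t w|%:E <= (gain_bound * expR (alpha / 2 * t))%:E)%E.
Proof.
move=> t0; have e0 := gain_rate_gt0; set e := gain_rate in e0 *.
apply: (@le_trans _ _ (\int[P]_w
   ((e^-1)%:E * ((expR (e * X t w))%:E + (expR (- e * X t w))%:E)))%E).
  apply: ge0_le_integral => //.
  - apply/measurable_EFinP; apply: measurableT_comp => //.
    exact: (drifted_measurable hF hB).
  - apply/measurable_EFinP; apply: measurable_funM => //.
    by apply: measurable_funD; apply: measurableT_comp => //;
      apply: measurable_funM => //; exact: (drifted_measurable hF hB).
  - move=> w _; rewrite -EFinD -EFinM lee_fin mulrC.
    exact: ler_norm_expR.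
have mexp b : measurable_fun setT (fun w => (expR (b * X t w))%:E).
  apply/measurable_EFinP; apply: measurableT_comp => //.
  by apply: measurable_funM => //; exact: (drifted_measurable hF hB).
rewrite ge0_integralZl//; last 3 first.
- by apply: emeasurable_funD.
- by move=> w _; rewrite -EFinD lee_fin addr_ge0 ?expR_ge0.
- by rewrite lee_fin invr_ge0 ltW.
rewrite ge0_integralD//.
rewrite !(exponential_moment hF hB)// -EFinD -EFinM lee_fin /gain_bound -/e.
rewrite [leRHS]mulrAC [leLHS]mulrC ler_pM2r ?invr_gt0//.
rewrite [leRHS]mulrDl; apply: lerD; rewrite -expRD ler_expR lerD2l ler_wpM2r//;
  apply: exponent_gain_rate; by rewrite ?normrN gtr0_norm.
Qed.

(** The integrand of the return as a function on the product space; clipping the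
    time at zero makes it measurable everywhere, the paths being continuous
    on nonnegative times only. *)
Definition gain (z : Omega * TR) : R := X (Num.max 0 z.2) z.1 * expR (- (alpha * z.2)).

Definition nonneg_times : set (Omega * TR) := setT `*` `[0, +oo[%classic.

Lemma gain_ge0E w t : 0 <= t -> gain (w, t) = X t w * expR (- (alpha * t)).
Proof. by move=> t0; rewrite /gain/= max_r. Qed.

Lemma measurable_gain : measurable_fun setT gain.
Proof.
apply: measurable_funM.
  apply: joint_measurable; last exact: drifted_continuous.
  by move=> t; exact: (drifted_measurable hF hB).
apply: measurableT_comp => //; apply: measurableT_comp => //.
apply: measurable_funM => //; exact: measurable_snd.
Qed.

Lemma measurable_nonneg_times : measurable nonneg_times.
Proof. exact: measurableX. Qed.

(** Integrating first over the sample space, the discounted mean decays like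
    the density of an exponential law of rate [alpha / 2]. *)
Lemma integrable_gain : (P \x mu)%E.-integrable nonneg_times (EFin \o gain).
Proof.
apply/integrable_mkcond; first exact: measurable_nonneg_times.
have mf : measurable_fun setT ((EFin \o gain) \_ nonneg_times).
  apply/measurable_restrict => //; first exact: measurable_nonneg_times.
  by apply: measurable_funTS; apply/measurable_EFinP; exact: measurable_gain.
apply/integrable21ltyP => //.
have a20 : 0 < alpha / 2 by rewrite divr_gt0.
pose K := gain_bound / (alpha / 2).
have K0 : 0 <= K.
  apply: divr_ge0; last exact: ltW.
  by apply: divr_ge0; [rewrite addr_ge0 ?expR_ge0|exact: ltW gain_rate_gt0].
apply: (@le_lt_trans _ _ (\int[mu]_t (K%:E * (exponential_pdf (alpha / 2) t)%:E))%E).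
  apply: ge0_le_integral => //.
  - by move=> t _; exact: integral_ge0.
  - apply: (@measurable_fun_fubini_tonelli_G _ _ _ _ _ _
      (fun z => `|((EFin \o gain) \_ nonneg_times) z|%E)) => //.
    exact: measurableT_comp.
  - by apply/measurable_EFinP/measurable_funM => //; exact: measurable_exponential_pdf.
  - move=> t _; rewrite -EFinM; have [t0|t0] := ltP t 0.
      rewrite lt0_exponential_pdf// mulr0 (eq_integral (cst 0%E)) ?integral0//.
      move=> w _; rewrite patchE ifF ?abse0//; apply/negP; rewrite inE => -[_ /=].
      by rewrite in_itv/= andbT leNgt t0.
    have tT : t \in `[0, +oo[%classic by rewrite inE/= in_itv/= andbT.
    rewrite (_ : (\int[P]_w _)%E =
        (\int[P]_w (`|X t w|%:E * (expR (- (alpha * t)))%:E))%E); last first.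
      apply: eq_integral => w _; rewrite patchE ifT; last first.
        by rewrite inE; split => //=; rewrite in_itv/= andbT.
      by rewrite /= gain_ge0E// normrM (ger0_norm (expR_ge0 _)) EFinM.
    rewrite ge0_integralZr//; last first.
      apply/measurable_EFinP; apply: measurableT_comp => //.
      exact: (drifted_measurable hF hB).
    apply: (le_trans (lee_wpmul2r _ (mean_norm_drifted t0))).
      by rewrite lee_fin expR_ge0.
    have e : expR (alpha / 2 * t) * expR (- (alpha * t)) = expR (- (alpha / 2) * t).
      by rewrite -expRD; congr expR; field.
    rewrite -EFinM lee_fin -[leLHS]mulrA e /exponential_pdf patchE tT.
    by rewrite /K [leRHS]mulrA divfK// gt_eqF.
rewrite ge0_integralZl//; last 2 first.
- by apply/measurable_EFinP; exact: measurable_exponential_pdf.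
- by move=> t _; rewrite lee_fin exponential_pdf_ge0// ltW.
by rewrite integral_exponential_pdf// mule1 ltry.
Qed.

Definition stopped_region (tau : Omega -> \bar R) : set (Omega * TR) :=
  [set z | 0 <= z.2 /\ (z.2%:E <= tau z.1)%E].

Lemma stopped_region_sub tau : stopped_region tau `<=` nonneg_times.
Proof. by move=> [w t] [/= t0 _]; split => //=; rewrite in_itv/= andbT. Qed.

(** Fubini: the expected pathwise integral is an integral over the region of the
    product space lying below the graph of the stopping rule. *)
Lemma discounted_return_region tau : measurable (stopped_region tau) ->
  discounted_return alpha P X tau =
  (\int[(P \x mu)%E]_(z in stopped_region tau) gain z)%:E.
Proof.
move=> mS; set S := stopped_region tau in mS *.
have iS : (P \x mu)%E.-integrable S (EFin \o gain).
  apply: integrableS integrable_gain => //; first exact: measurable_nonneg_times.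
  exact: stopped_region_sub.
have igS : (P \x mu)%E.-integrable setT ((EFin \o gain) \_ S).
  by apply/(integrable_mkcond _ mS).
pose h w := (\int[mu]_t ((EFin \o gain) \_ S) (w, t))%E.
have ih : P.-integrable setT h by exact: integrable_fubini_F.
rewrite /Rintegral fineK; last exact: integrable_fin_num.
rewrite /discounted_return unlock integral_mkcond.
rewrite -(integral12_prod_meas1 igS).
transitivity (\int[P]_w (fine (h w))%:E)%E.
  apply: eq_integral => w _; congr (fine _)%:E.
  rewrite integral_mkcond; apply: eq_integral => t _.
  rewrite !patchE.
  have -> : (t \in [set t0 | 0 <= t0 /\ (t0%:E <= tau w)%E]) = ((w, t) \in S).
    by apply/idP/idP; rewrite !inE.
  by case: ifPn => //; rewrite inE => -[t0 _]; rewrite /= gain_ge0E.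
apply: ae_eq_integral => //.
- apply/measurable_EFinP; apply: measurableT_comp => //.
  exact: measurable_int ih.
- exact: measurable_int ih.
- have := integrable_ae measurableT ih; apply: filterS => w /= /(_ I) hw _.
  by rewrite fineK.
Qed.

End fixed_start.
End discounted_gain.

(** * Dynkin's formula for grid-valued times *)

(** The mean of the motion after time [s] is affine in time, so this is the
    expected discounted gain over one step. *)
Lemma discounted_affine_integral {R : realType} (alpha a b s t : R) :
  alpha != 0 -> s < t ->
  (\int[lebesgue_measure]_(r in `]s, t])
     (expR (- (alpha * r)) * (a + b * (r - s)))%:E =
   (expR (- (alpha * s)) * (a / alpha + b / alpha ^+ 2) -
    expR (- (alpha * t)) * ((a + b * (t - s)) / alpha + b / alpha ^+ 2))%:E)%E.
Proof.
move=> alpha0 st.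
pose G (r : R) := - (expR (- (alpha * r)) * ((a + b * (r - s)) / alpha + b / alpha ^+ 2)).
pose g (r : R) := expR (- (alpha * r)) * (a + b * (r - s)).
have dG (r : R) : is_derive r 1 G (g r).
  have de : is_derive r 1 (fun r : R => expR (- (alpha * r)))
      (expR (- (alpha * r)) * - alpha).
    have dl : is_derive r 1 (fun r : R => - (alpha * r)) (- alpha).
      have -> : (fun r : R => - (alpha * r)) = - (alpha \*: (id : R -> R^o)).
        by apply/funext => u.
      by apply: is_derive_eq; rewrite /GRing.scale/= mulr1.
    exact: (@is_derive1_comp _ expR (fun r : R => - (alpha * r)) r _ _
      (is_derive_expR _) dl).
  have dl : is_derive r 1 (fun r : R => (a + b * (r - s)) / alpha + b / alpha ^+ 2) (b / alpha).
    have -> : (fun r : R => (a + b * (r - s)) / alpha + b / alpha ^+ 2) =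
       cst ((a - b * s) / alpha + b / alpha ^+ 2) + ((b / alpha) \*: (id : R -> R^o)).
      by apply/funext => u; rewrite fctE /= /GRing.scale/=; field.
    by apply: is_derive_eq; rewrite /GRing.scale/= mulr1 add0r.
  have -> : g r = - (expR (- (alpha * r)) *: (b / alpha) +
      ((a + b * (r - s)) / alpha + b / alpha ^+ 2) *:
      (expR (- (alpha * r)) * - alpha)).
    by rewrite /g /GRing.scale/=; field.
  exact: (is_deriveN (is_deriveM de dl)).
have cg : continuous g.
  move=> r; apply: cvgM.
    apply: continuous_comp; last exact: continuous_expR.
    by apply: cvgN; apply: cvgM; [exact: cvg_cst|exact: cvg_id].
  apply: cvgD; first exact: cvg_cst.
  apply: cvgM; first exact: cvg_cst.
  by apply: cvgB; [exact: cvg_id|exact: cvg_cst].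
rewrite integral_itv_obnd_cbnd; last first.
  by apply/measurable_EFinP/measurable_funTS; exact: continuous_measurable_fun.
rewrite (@continuous_FTC2 _ g G)//.
- by rewrite -EFinB /G opprK addrC subrr mulr0 addr0.
- exact: continuous_subspaceT.
- have cG : continuous G.
    by move=> r; apply: differentiable_continuous; apply/derivable1_diffP; case: (dG r).
  split.
  + by move=> r _; case: (dG r).
  + exact/cvg_at_right_filter/cG.
  + exact/cvg_at_left_filter/cG.
- by move=> r _; rewrite derive1E; case: (dG r) => _ ->.
Qed.

Section value_process.
Context {R : realType} {d : measure_display} {Omega : measurableType d}.
Variables (P : probability Omega R) (F : R -> set (set Omega)) (B : R -> Omega -> R).
Hypotheses (hF : is_filtration F) (hB : is_brownian_motion P F B).
Variables (alpha nu sigma : R).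
Hypotheses (alpha0 : 0 < alpha).
Local Notation mu := (@lebesgue_measure R).
Local Notation TR := (measurableTypeR R).
Variables (lam C : R).
Hypothesis lamE : exponent nu sigma lam = alpha.

(** The general affine-plus-exponential solution [v] of
    [(sigma ^+ 2 / 2) v'' + nu v' - alpha v + y = 0] without the growing
    exponential; smooth fit fixes [C] later. *)
Definition continuation_value (y : R) :=
  y / alpha + nu / alpha ^+ 2 + C * expR (lam * y).

Variable x : R.
Local Notation X := (drifted_brownian_motion nu sigma B x).
Local Notation gain := (gain B alpha nu sigma x).

Definition value_process (t : R) (w : Omega) :=
  expR (- (alpha * t)) * continuation_value (X t w).

(** Both parts of the value are martingales up to explicit terms: the mean of
    the linear part gains the drift, and the exponential part keeps its
    discounted mean because [exponent lam] is the discount rate. *)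
Lemma Rintegral_value_process (A : set Omega) (s t : R) :
  0 <= s -> s <= t -> F s A ->
  P.-integrable A (EFin \o value_process t) /\
  \int[P]_(w in A) value_process t w =
   expR (- (alpha * t)) * ((\int[P]_(w in A) X s w + nu * fine (P A) * (t - s)) / alpha
     + nu * fine (P A) / alpha ^+ 2) +
   C * (expR (- (alpha * s)) * \int[P]_(w in A) expR (lam * X s w)).
Proof.
move=> s0 st FA; have mA : measurable A := filtration_measurable hF s0 FA.
have t0 := le_trans s0 st.
have iX : P.-integrable A (EFin \o X t).
  exact: (integrableS measurableT mA (@subsetT _ _) (integrable_drifted hF hB nu sigma x t0)).
have ie : P.-integrable A (EFin \o (fun w => expR (lam * X t w))).
  exact: (integrableS measurableT mA (@subsetT _ _) (integrable_expR hF hB nu sigma x lam t0)).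
have i1 : P.-integrable A (EFin \o (fun=> 1)).
  apply: (integrableS measurableT mA (@subsetT _ _)).
  exact: finite_measure_integrable_cst.
pose e := expR (- (alpha * t)).
have i2 : P.-integrable A (EFin \o (fun w => e / alpha * X t w)).
  exact: (integrableZl mA _ iX).
have i3 : P.-integrable A (EFin \o (fun w => (e * C) * expR (lam * X t w))).
  exact: (integrableZl mA _ ie).
have i4 : P.-integrable A (EFin \o (fun w => (e * nu / alpha ^+ 2) * 1)).
  exact: (integrableZl mA _ i1).
have i24 : P.-integrable A (EFin \o
    (fun w => e / alpha * X t w + (e * nu / alpha ^+ 2) * 1)).
  exact: (integrableD mA i2 i4).
have vE : value_process t =
    (fun w => e / alpha * X t w + (e * nu / alpha ^+ 2) * 1 + (e * C) * expR (lam * X t w)).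
  by apply/funext => w; rewrite /value_process /continuation_value -/e; field; rewrite gt_eqF.
split.
  by rewrite vE; exact: (integrableD mA i24 i3).
rewrite vE RintegralD// RintegralD// !RintegralZl//.
have -> : \int[P]_(w in A) expR (lam * X t w) =
    expR (alpha * (t - s)) * \int[P]_(w in A) expR (lam * X s w).
  rewrite /Rintegral (exponential_martingale hF hB _ _ _ _ s0 st FA) lamE.
  rewrite muleC fineM//=; apply: integrable_fin_num => //.
  exact: (integrableS measurableT mA (@subsetT _ _) (integrable_expR hF hB nu sigma x lam s0)).
have -> : expR (- (alpha * s)) = e * expR (alpha * (t - s)).
  by rewrite /e -expRD; congr expR; ring.
rewrite (drifted_mean hF hB nu sigma x s0 st FA) Rintegral_cst// -/e.
by field; rewrite gt_eqF.
Qed.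

Lemma mean_value_process0 : \int[P]_w value_process 0 w = continuation_value x.
Proof.
rewrite /Rintegral (ae_eq_integral (cst (continuation_value x)%:E))//.
- by rewrite integral_cst//= [X in (_ * X)%E]probability_setT mule1.
- have F0T : F 0 setT by rewrite -(past_measurableE hF)//; exact: measurableT.
  have [+ _] := Rintegral_value_process (lexx 0) (lexx 0) F0T.
  exact: measurable_int.
- have := brownian_start hB; apply: filterS => w B0 _.
  by rewrite /value_process /drifted_brownian_motion B0 !mulr0 !addr0 oppr0 expR0 mul1r.
Qed.

(** Dynkin's formula over one time step, on an event of the past. Both sides are
    explicit in the mean of [X s] on the event: the exponential parts cancel,
    and the affine parts differ by the primitive of the expected gain. *)
Lemma running_gain (A : set Omega) (s t : R) :
  0 <= s -> s < t -> F s A ->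
  \int[(P \x mu)%E]_(z in A `*` `]s, t]%classic) gain z =
  \int[P]_(w in A) value_process s w - \int[P]_(w in A) value_process t w.
Proof.
move=> s0 st FA; have mA : measurable A := filtration_measurable hF s0 FA.
have [_ ->] := Rintegral_value_process s0 (lexx s) FA.
have [_ ->] := Rintegral_value_process s0 (ltW st) FA.
rewrite subrr mulr0 addr0 [X in _ - X]addrC opprD addrA addrK.
set m := \int[P]_(w in A) X s w; set b := nu * fine (P A).
pose D : set (Omega * TR) := A `*` `]s, t]%classic.
have mD : measurable D by exact: measurableX.
have iD : (P \x mu)%E.-integrable D (EFin \o gain).
  apply: (integrableS (measurable_nonneg_times) mD _
     (integrable_gain hF hB nu sigma alpha0 x)).
  move=> [w r] [/= _]; rewrite in_itv/= => /andP[sr _]; split => //=.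
  by rewrite in_itv/= andbT (le_trans s0 (ltW sr)).
have iDT : (P \x mu)%E.-integrable setT ((EFin \o gain) \_ D).
  exact/(integrable_mkcond _ mD).
rewrite /Rintegral -[RHS]/(fine (_%:E)) -discounted_affine_integral ?gt_eqF//.
congr fine; rewrite integral_mkcond -(integral21_prod_meas1 iDT) [RHS]integral_mkcond.
apply: eq_integral => r _; rewrite patchE; case: ifPn => rst; last first.
  rewrite /fubini_G (eq_integral (cst 0%E)) ?integral0// => w _.
  rewrite patchE ifF//; apply/negP; rewrite inE => -[_ /=]; apply/negP.
  by move: rst; rewrite notin_setE/= => /negP.
have := rst; rewrite inE/= in_itv/= => /andP[sr rt].
have r0 : 0 <= r := le_trans s0 (ltW sr).
have iX : P.-integrable A (EFin \o X r).
  exact: (integrableS measurableT mA (@subsetT _ _) (integrable_drifted hF hB nu sigma x r0)).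
transitivity (\int[P]_(w in A) ((expR (- (alpha * r)))%:E * (X r w)%:E))%E.
  rewrite /fubini_G [RHS]integral_mkcond; apply: eq_integral => w _.
  rewrite !patchE.
  have -> : ((w, r) \in D) = (w \in A).
    apply/idP/idP; rewrite !inE; first by case.
    by move=> Aw; split => //=; rewrite in_itv/= sr.
  by case: ifPn => // _; rewrite /= gain_ge0E// mulrC EFinM.
rewrite integralZl// EFinM; congr (_ * _)%E.
rewrite -[LHS]fineK; last exact: integrable_fin_num.
congr (_%:E); have := drifted_mean hF hB nu sigma x s0 (ltW sr) FA.
by rewrite /Rintegral => ->; rewrite /m /b /Rintegral; ring.
Qed.

End value_process.

Section rounding.
Context {T : Type}.
Variable A : nat -> set T.
Hypothesis decA : forall k, A k.+1 `<=` A k.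

(** A rule observed on a mesh is given by the decreasing events [A k] of not
    having stopped before the mesh point [k]. Counting those that hold among the
    first [N] gives the index of the least mesh point exceeding the rule,
    capped at [N]. *)
Definition steps (N : nat) (w : T) : nat := \sum_(k < N) (w \in A k).

Lemma stepsS N w : steps N.+1 w = (steps N w + (w \in A N))%N.
Proof. by rewrite /steps big_ord_recr. Qed.

Lemma leq_steps N w : (steps N w <= N)%N.
Proof.
elim: N => [|N IH]; first by rewrite /steps big_ord0.
by rewrite stepsS -addn1 leq_add// leq_b1.
Qed.

Lemma decA_le k l : (k <= l)%N -> A l `<=` A k.
Proof.
move=> /subnK <-; elim: (l - k)%N => [//|n IH].
by rewrite addSn; apply: subset_trans IH; exact: decA.
Qed.

Lemma steps_full N w : A N w -> steps N w = N.
Proof.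
elim: N => [|N IH] AN; first by rewrite /steps big_ord0.
have AN' := decA AN; rewrite stepsS IH//.
by rewrite mem_set// addn1.
Qed.

Lemma ltn_steps N k w : (k < N)%N -> (k < steps N w)%N = (w \in A k).
Proof.
elim: N k => [//|N IH] k; rewrite ltnS stepsS => kN.
have [AN|AN] := boolP (w \in A N).
  rewrite steps_full ?addn1 ?ltnS ?kN; last by move: AN; rewrite inE.
  by apply/esym/mem_set; apply: (decA_le kN); exact: set_mem.
rewrite addn0; move: kN; rewrite leq_eqVlt => /predU1P[->|kN]; last exact: IH.
by rewrite (negbTE AN) ltnNge leq_steps.
Qed.

End rounding.

Section stopped_processes.
Context {R : realType} {d : measure_display} {Omega : measurableType d}.
Variables (P : probability Omega R) (A : nat -> set Omega).
Hypotheses (decA : forall k, A k.+1 `<=` A k) (mA : forall k, measurable (A k)).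
Variable Y : nat -> Omega -> R.
Hypothesis iY : forall k, P.-integrable setT (EFin \o Y k).
Local Notation steps := (steps A).

Lemma stopped_step N :
  (fun w => Y (steps N.+1 w) w) =
  (fun w => Y (steps N w) w + ((Y N.+1 \- Y N) \_ (A N)) w).
Proof.
apply/funext => w; rewrite stepsS patchE; case: ifPn => wA; last by rewrite addn0 addr0.
by rewrite (steps_full decA (set_mem wA)) addn1/= addrC subrK.
Qed.

Lemma integrable_step N :
  P.-integrable setT (EFin \o ((Y N.+1 \- Y N) \_ (A N))).
Proof.
rewrite -restrict_EFin; apply/(integrable_mkcond _ (mA N)).
apply: (integrableS measurableT) => //.
exact: (integrableB measurableT (iY N.+1) (iY N)).
Qed.

Lemma integrable_stopped N : P.-integrable setT (EFin \o (fun w => Y (steps N w) w)).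
Proof.
elim: N => [|N IH].
  apply: eq_integrable (iY 0) => // w _ /=.
  by rewrite /steps big_ord0.
by rewrite stopped_step; exact: (integrableD measurableT IH (integrable_step N)).
Qed.

Lemma Rintegral_stopped_step N :
  \int[P]_w Y (steps N.+1 w) w =
  \int[P]_w Y (steps N w) w +
  (\int[P]_(w in A N) Y N.+1 w - \int[P]_(w in A N) Y N w).
Proof.
rewrite stopped_step RintegralD//; last 2 first.
- exact: integrable_stopped.
- exact: integrable_step.
by rewrite -Rintegral_mkcond RintegralB//; exact: (integrableS measurableT).
Qed.

(** Optional stopping reduces to the martingale identity on one step because
    the events of continuing are past. *)
Lemma Rintegral_stopped_martingale N :
  (forall k, \int[P]_(w in A k) Y k.+1 w = \int[P]_(w in A k) Y k w) ->
  \int[P]_w Y (steps N w) w = \int[P]_w Y 0 w.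
Proof.
move=> mart; elim: N => [|N IH].
  by apply: eq_Rintegral => w _; rewrite /steps big_ord0.
by rewrite Rintegral_stopped_step mart subrr addr0.
Qed.

End stopped_processes.

Section stopped_gain.
Context {R : realType} {d : measure_display} {Omega : measurableType d}.
Variables (P : probability Omega R) (F : R -> set (set Omega)) (B : R -> Omega -> R).
Hypotheses (hF : is_filtration F) (hB : is_brownian_motion P F B).
Variables (alpha nu sigma : R).
Hypotheses (alpha0 : 0 < alpha).
Local Notation mu := (@lebesgue_measure R).
Local Notation TR := (measurableTypeR R).
Variables (lam C : R).
Hypothesis lamE : exponent nu sigma lam = alpha.
Variable x : R.
Local Notation gain := (gain B alpha nu sigma x).
Local Notation value_process := (value_process B alpha nu sigma lam C x).
Variables (h : R) (A : nat -> set Omega).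
Hypotheses (h0 : 0 < h) (decA : forall k, A k.+1 `<=` A k).
Hypothesis FA : forall k, F (k%:R * h) (A k).
Local Notation steps := (steps A).

Let kh0 (k : nat) : 0 <= k%:R * h. Proof. by rewrite mulr_ge0// ltW. Qed.

Let mA k : measurable (A k).
Proof. exact: (filtration_measurable hF (kh0 k) (FA k)). Qed.

Definition grid_region (N : nat) : set (Omega * TR) :=
  [set z | 0 <= z.2 /\ z.2 <= (steps N z.1)%:R * h].

Lemma grid_region0 : grid_region 0 = setT `*` [set 0].
Proof.
apply/seteqP; split => [[w t]|[w t]]; rewrite /grid_region/= /steps big_ord0 mul0r.
  by move=> [t0 t0']; split => //; apply/eqP; rewrite eq_le t0 t0'.
by move=> [_ ->].
Qed.

Lemma grid_regionS N : grid_region N.+1 =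
  grid_region N `|` (A N `*` `]N%:R * h, N.+1%:R * h]%classic).
Proof.
apply/seteqP; split => [[w t]|[w t]]; rewrite /grid_region/= stepsS in_itv/=.
- move=> [t0]; have [wA|wA] := boolP (w \in A N); last by rewrite addn0; left.
  rewrite (steps_full decA (set_mem wA)) addn1 => tN.
  have [tN'|tN'] := leP t (N%:R * h); first by left.
  by right; split; [exact: set_mem|rewrite tN].
- move=> [[t0 tN]|[wA /andP[tN tN']]].
    by split => //; apply: (le_trans tN); rewrite ler_pM2r// ler_nat leq_addr.
  rewrite (steps_full decA wA) mem_set// addn1; split => //.
  exact: (le_trans (kh0 N) (ltW tN)).
Qed.

Lemma measurable_grid_region N : measurable (grid_region N).
Proof.
elim: N => [|N IH].
  by rewrite grid_region0; apply: measurableX => //; exact: measurable_set1.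
by rewrite grid_regionS; apply: measurableU => //; exact: measurableX.
Qed.

Lemma grid_region_sub N : grid_region N `<=` nonneg_times.
Proof. by move=> [w t] [/= t0 _]; split => //=; rewrite in_itv/= andbT. Qed.

Lemma integrable_value_process t : 0 <= t -> P.-integrable setT (EFin \o value_process t).
Proof.
move=> t0; have F0T : F 0 setT by rewrite -(past_measurableE hF)//; exact: measurableT.
by have [] := Rintegral_value_process hF hB alpha0 C lamE x (lexx 0) t0 F0T.
Qed.

(** Dynkin's formula up to a bounded grid-valued time: each further step adds to
    the region the strip over the event of continuing, whose gain is exactly
    the loss of value over that strip. *)
Lemma grid_gain N :
  \int[(P \x mu)%E]_(z in grid_region N) gain z +
  \int[P]_w value_process ((steps N w)%:R * h) w = continuation_value alpha nu lam C x.
Proof.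
rewrite -(mean_value_process0 hF hB alpha0 C lamE x).
pose Y k := value_process (k%:R * h).
have iY k : P.-integrable setT (EFin \o Y k) by exact: integrable_value_process.
elim: N => [|N <-].
  rewrite /Rintegral null_set_integral//=; last 3 first.
  - exact: measurable_grid_region.
  - apply: measurable_funTS; apply/measurable_EFinP.
    exact: (measurable_gain hF hB).
  - by rewrite grid_region0 product_measure1E//= lebesgue_measure_set1 mule0.
  rewrite add0r; congr fine; apply: eq_integral => w _.
  by rewrite /steps big_ord0 mul0r.
rewrite (Rintegral_stopped_step decA mA iY N) grid_regionS Rintegral_setU//; last 4 first.
- exact: measurable_grid_region.
- exact: measurableX.
- rewrite -grid_regionS.
  apply: (integrableS (measurable_nonneg_times) (measurable_grid_region _) (@grid_region_sub _)).
  exact: (integrable_gain hF hB nu sigma alpha0 x).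
- apply/disj_setPS => -[w t] [[/= _ tN] [wA]] /=; rewrite in_itv/= => /andP[Nt _].
  by move: tN; rewrite (steps_full decA wA) leNgt Nt.
have NN : N%:R * h < N.+1%:R * h by rewrite ltr_pM2r// ltr_nat.
rewrite (running_gain hF hB alpha0 C lamE x (kh0 N) NN (FA N)).
by rewrite addrACA -[X in _ + (_ + X)]opprB subrr addr0.
Qed.

End stopped_gain.

(** * Optional times and their approximation from above *)

Section region_convergence.
Context {R : realType} {d : measure_display} {T : measurableType d}.
Variables (m : {measure set T -> \bar R}) (D : set T) (g : T -> R).
Hypotheses (mD : measurable D) (ig : m.-integrable D (EFin \o g)).
Variables (S_ : nat -> set T) (S : set T).
Hypotheses (mS_ : forall n, measurable (S_ n)) (S_D : forall n, S_ n `<=` D).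
Hypothesis S_S : forall z, \forall n \near \oo, S_ n z <-> S z.

Lemma region_limit_measurable : measurable S.
Proof.
have -> : S = \bigcup_k \bigcap_(n in [set n | (k <= n)%N]) S_ n.
  apply/seteqP; split => [z Sz|z [k _ Sk]].
    have [k _ Hk] := S_S z; exists k => // n /= kn.
    exact: ((Hk n kn).2 Sz).
  have [l _ Hl] := S_S z.
  apply: (proj1 (Hl (maxn k l) _)); first exact: leq_maxr.
  by apply: Sk => /=; exact: leq_maxl.
by apply: bigcupT_measurable => k; apply: bigcap_measurable => //; exists k => /=.
Qed.

Lemma region_limit_sub : S `<=` D.
Proof.
move=> z Sz; have [k _ Hk] := S_S z.
exact: (S_D ((Hk k (leqnn k)).2 Sz)).
Qed.

Lemma Rintegral_region_cvg :
  \int[m]_(z in S_ n) g z @[n --> \oo] --> \int[m]_(z in S) g z.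
Proof.
have mS := region_limit_measurable.
have SD := region_limit_sub.
have mg : measurable_fun D (EFin \o g) := measurable_int _ ig.
have iD : m.-integrable setT ((EFin \o g) \_ D) by exact/(integrable_mkcond _ mD).
have iS E : measurable E -> E `<=` D -> m.-integrable E (EFin \o g).
  by move=> mE ED; exact: (integrableS mD mE ED ig).
have mE E : measurable E -> E `<=` D -> measurable_fun setT ((EFin \o g) \_ E).
  move=> mE ED; apply/measurable_restrict => //; rewrite setTI.
  exact: (measurable_funS mD ED mg).
apply: fine_cvg; rewrite fineK; last exact: (integrable_fin_num mS (iS _ mS SD)).
rewrite integral_mkcond.
rewrite (_ : (fun n => _) = (fun n => \int[m]_z ((EFin \o g) \_ (S_ n)) z)%E); last first.
  by apply/funext => n; rewrite integral_mkcond.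
have := @dominated_convergence _ _ _ m setT measurableT
  (fun n => (EFin \o g) \_ (S_ n)) ((EFin \o g) \_ S)
  (abse \o ((EFin \o g) \_ D)).
case => //.
- by move=> n; exact: mE.
- exact: mE.
- apply: aeW => z _; apply: cvg_near_cst.
  apply: filterS (S_S z) => n SnS; rewrite !patchE.
  suff -> : (z \in S_ n) = (z \in S) by [].
  by apply/idP/idP; rewrite !inE => /SnS.
- exact: integrable_abse.
- apply: aeW => z n _; rewrite /= !patchE; case: ifPn => [zS|_].
    by rewrite mem_set//; apply: (@S_D n); exact: set_mem zS.
  by rewrite abse0 abse_ge0.
Qed.

End region_convergence.

Section optional_times.
Context {R : realType} {d : measure_display} {Omega : measurableType d}.
Variable F : R -> set (set Omega).
Hypothesis hF : is_filtration F.

(** Exit times from open sets only satisfy this weakening of the stopping time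
    condition when the filtration is not right-continuous; it is all that
    discretization from above needs. *)
Definition optional_time (tau : Omega -> \bar R) :=
  (forall w, 0 <= tau w)%E /\
  (forall t, 0 <= t -> F t [set w | (tau w < t%:E)%E]).

(** [tau < t] holds exactly when [tau <= t - 1 / (n + 1)] for some [n]. *)
Lemma stopping_time_optional tau : stopping_times F tau -> optional_time tau.
Proof.
move=> [tau0 tauF]; split => // t t0.
rewrite -(past_measurableE hF _ t0).
have -> : [set w | (tau w < t%:E)%E] =
    \bigcup_n [set w | 0 <= t - n.+1%:R^-1 /\ (tau w <= (t - n.+1%:R^-1)%:E)%E].
  apply/seteqP; split => [w /= wt|w [n _ [_ /= wt]]].
    have : tau w \is a fin_num.
      by rewrite ge0_fin_numE// (lt_trans wt)// ltry.
    move=> /fineK tauE; rewrite -tauE lte_fin in wt.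
    have [n ht] : exists n : nat, n.+1%:R^-1 < t - fine (tau w).
      have := @cvg_harmonic R => /cvgr_lt/(_ (t - fine (tau w))).
      by rewrite subr_gt0 => /(_ wt)[n _ /(_ n (leqnn n))]; exists n.
    have f0 : 0 <= fine (tau w) by rewrite fine_ge0.
    exists n => //=; split.
      by rewrite subr_ge0 ltW// (lt_le_trans ht)// lerBlDr lerDl.
    by rewrite -tauE lee_fin lerBrDr addrC -lerBrDr ltW.
  rewrite (le_lt_trans wt)// lte_fin ltrBlDr ltrDl invr_gt0//.
apply: bigcupT_measurable => n; have [tn|tn] := leP 0 (t - n.+1%:R^-1).
  rewrite (_ : [set w | _] = [set w | (tau w <= (t - n.+1%:R^-1)%:E)%E]); last first.
    by apply/seteqP; split => w //= [].
  rewrite (past_measurableE hF _ t0); apply: (filtration_monotone hF tn); last exact: tauF.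
  by rewrite lerBlDr lerDl invr_ge0.
by rewrite (_ : [set w | _] = set0)//; apply/seteqP; split => w //= [].
Qed.

Variable tau : Omega -> \bar R.
Hypothesis otau : optional_time tau.

Definition mesh (n : nat) : R := n.+1%:R^-1.
Definition reached (n k : nat) : set Omega := [set w | ((k%:R * mesh n)%:E <= tau w)%E].

Lemma mesh_gt0 n : 0 < mesh n. Proof. by rewrite invr_gt0. Qed.

Lemma reached_past n k : F (k%:R * mesh n) (reached n k).
Proof.
have kn : 0 <= k%:R * mesh n by rewrite mulr_ge0// ltW// mesh_gt0.
rewrite -(past_measurableE hF _ kn) -[reached n k]setCK; apply: measurableC.
rewrite (past_measurableE hF _ kn) (_ : ~` _ = [set w | (tau w < (k%:R * mesh n)%:E)%E]).
  exact: (otau.2).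
by apply/seteqP; split => w /=; rewrite /reached/= ltNge => /negP.
Qed.

Lemma reached_dec n k : reached n k.+1 `<=` reached n k.
Proof.
move=> w; rewrite /reached/=; apply: le_trans.
by rewrite lee_fin ler_pM2r ?mesh_gt0// ler_nat.
Qed.

Variable T : nat.
Definition rounded n w : R := (steps (reached n) (T * n.+1) w)%:R * mesh n.

Lemma horizonE n : (T * n.+1)%N%:R * mesh n = T%:R.
Proof. by rewrite natrM /mesh mulfK. Qed.

Lemma rounded_ge0 n w : 0 <= rounded n w.
Proof. by rewrite mulr_ge0// ltW// mesh_gt0. Qed.

Lemma rounded_le n w : rounded n w <= T%:R.
Proof. by rewrite -(horizonE n) ler_pM2r ?mesh_gt0// ler_nat leq_steps. Qed.

Lemma rounded_above n w t : t <= T%:R -> (t%:E <= tau w)%E -> t <= rounded n w.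
Proof.
move=> tT tt; have := leq_steps (reached n) (T * n.+1) w.
rewrite leq_eqVlt => /predU1P[E|lt]; first by rewrite /rounded E horizonE.
have := ltn_steps (@reached_dec n) w lt; rewrite ltnn => /esym/negbT.
rewrite notin_setE /reached/= => /negP; rewrite -ltNge => lt'.
by rewrite -lee_fin (le_trans tt)// ltW.
Qed.

Lemma rounded_below n w : ((rounded n w - mesh n)%:E <= tau w)%E.
Proof.
rewrite /rounded; case E : (steps _ _ w) => [|k].
  rewrite mul0r sub0r (le_trans _ (otau.1 w))// lee_fin oppr_le0.
  by rewrite ltW// mesh_gt0.
have lt : (k < T * n.+1)%N by rewrite -ltnS -E ltnS leq_steps.
have := ltn_steps (@reached_dec n) w lt; rewrite E ltnSn => /esym/set_mem.
by rewrite /reached/=; congr (_%:E <= _)%E; rewrite -natr1; ring.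
Qed.

Lemma rounded_cvg w u : (tau w = u%:E \/ (u = T%:R /\ (T%:R%:E <= tau w)%E)) ->
  u <= T%:R -> rounded n w @[n --> \oo] --> u.
Proof.
move=> tu uT.
apply: (@squeeze_cvgr _ _ _ _ (fun=> u) (fun n => u + mesh n)).
- near=> n; have ut : (u%:E <= tau w)%E by case: tu => [->|[-> //]].
  rewrite rounded_above//=; case: tu => [E|[-> _]].
    by have := rounded_below n w; rewrite E lee_fin; lra.
  by have := rounded_le n w; have := mesh_gt0 n; lra.
- exact: cvg_cst.
- rewrite -[X in _ --> X]addr0; apply: cvgD; first exact: cvg_cst.
  exact: cvg_harmonic.
Unshelve. all: by end_near. Qed.

Definition capped_region : set (Omega * measurableTypeR R) :=
  [set z | [/\ 0 <= z.2, z.2 <= T%:R & (z.2%:E <= tau z.1)%E]].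

(** The rounded times lie above the rule by at most one mesh: points below the
    graph stay below, and points strictly above are eventually above. *)
Lemma grid_region_near (z : Omega * measurableTypeR R) : \forall n \near \oo,
  grid_region (mesh n) (reached n) (T * n.+1) z <-> capped_region z.
Proof.
case: z => w t; rewrite /grid_region/= /capped_region/=.
have [tt|tt] := leP t%:E (tau w).
  near=> n; split => [[t0 tr]|[t0 tT _]]; split => //.
    exact: (le_trans tr (rounded_le n w)).
  exact: rounded_above.
have : tau w \is a fin_num by rewrite ge0_fin_numE ?otau.1// (lt_trans tt)// ltry.
move=> /fineK tauE; rewrite -tauE lte_fin in tt.
near=> n; split => [[t0 tr]|[_ _]//].
exfalso; have := rounded_below n w; rewrite -tauE lee_fin.
have : mesh n < t - fine (tau w).
  near: n; have := @cvg_harmonic R => /cvgr_lt; apply.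
  by rewrite subr_gt0.
by rewrite /rounded; lra.
Unshelve. all: by end_near. Qed.

End optional_times.

Lemma capped_region_near {R : realType} {d : measure_display} {Omega : measurableType d}
    (tau : Omega -> \bar R) (z : Omega * measurableTypeR R) : \forall n \near \oo,
  capped_region tau n z <-> stopped_region tau z.
Proof.
case: z => w t; rewrite /stopped_region/= /capped_region/=.
near=> n; split => [[]//|[t0 tt]]; split => //.
near: n; exact: nbhs_infty_ger.
Unshelve. all: by end_near. Qed.

(** * Verification of the candidate value *)

Section verification.
Context {R : realType} {d : measure_display} {Omega : measurableType d}.
Variables (P : probability Omega R) (F : R -> set (set Omega)) (B : R -> Omega -> R).
Hypotheses (hF : is_filtration F) (hB : is_brownian_motion P F B).
Variables (alpha nu sigma : R).
Hypotheses (alpha0 : 0 < alpha).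
Local Notation mu := (@lebesgue_measure R).
Local Notation TR := (measurableTypeR R).
Variables (lam C : R).
Hypothesis lamE : exponent nu sigma lam = alpha.
Local Notation continuation_value := (continuation_value alpha nu lam C).
Variable x : R.
Local Notation X := (drifted_brownian_motion nu sigma B x).
Local Notation gain := (gain B alpha nu sigma x).
Local Notation value_process := (value_process B alpha nu sigma lam C x).

Variable tau : Omega -> \bar R.
Hypothesis otau : optional_time F tau.
Local Notation mesh := (@mesh R).
Local Notation steps n := (steps (reached tau n)).
Local Notation rounded := (rounded tau).
Local Notation area S := (\int[(P \x mu)%E]_(z in S) gain z).
Local Notation grid n T := (grid_region (mesh n) (reached tau n) (T * n.+1)).

Let FA n k : F (k%:R * mesh n) (reached tau n k).
Proof. exact: (reached_past hF otau). Qed.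

Let mA n k : measurable (reached tau n k).
Proof.
by apply: (filtration_measurable hF _ (FA n k)); rewrite mulr_ge0// ltW// mesh_gt0.
Qed.

Let decA n k : reached tau n k.+1 `<=` reached tau n k.
Proof. exact: reached_dec. Qed.

Let mgrid n T : measurable (grid n T).
Proof. exact: (measurable_grid_region hF (mesh_gt0 n) (@decA n) (FA n)). Qed.

Lemma grid_area_cvg T : area (grid n T) @[n --> \oo] --> area (capped_region tau T).
Proof.
apply: (Rintegral_region_cvg measurable_nonneg_times
  (integrable_gain hF hB nu sigma alpha0 x)).
- by move=> n; exact: mgrid.
- by move=> n; exact: grid_region_sub.
- by move=> z; exact: (grid_region_near otau).
Qed.

Lemma measurable_capped T : measurable (capped_region tau T).
Proof.
apply: (@region_limit_measurable _ _ (fun n => grid n T)) => [n|z]; first exact: mgrid.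
exact: (grid_region_near otau).
Qed.

Lemma measurable_stopped : measurable (stopped_region tau).
Proof.
apply: (@region_limit_measurable _ _ (fun n => capped_region tau n)) => [n|z].
  exact: measurable_capped.
exact: capped_region_near.
Qed.

Lemma capped_area_cvg : area (capped_region tau T) @[T --> \oo] --> area (stopped_region tau).
Proof.
apply: (Rintegral_region_cvg measurable_nonneg_times
  (integrable_gain hF hB nu sigma alpha0 x)).
- by move=> n; exact: measurable_capped.
- by move=> n [w t] [/= t0 _ _]; split => //=; rewrite in_itv/= andbT.
- by move=> z; exact: capped_region_near.
Qed.

Lemma grid_areaE n T :
  area (grid n T) + \int[P]_w value_process (rounded T n w) w = continuation_value x.
Proof. exact: (grid_gain hF hB alpha0 C lamE x (mesh_gt0 n) (@decA n) (FA n)). Qed.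

(** The remaining value at the rounded times is nonnegative, so what has been
    earned is at most the initial value. *)
Lemma area_le_continuation_value : (forall y, 0 <= continuation_value y) ->
  area (stopped_region tau) <= continuation_value x.
Proof.
move=> v_ge0; apply: (cvgr_to_le capped_area_cvg); near=> T.
apply: (cvgr_to_le (@grid_area_cvg T)); near=> n.
rewrite -(grid_areaE n T) lerDl; apply: Rintegral_ge0 => w _.
by rewrite mulr_ge0 ?expR_ge0.
Unshelve. all: by end_near. Qed.

(** Optional stopping of the exponential martingale, whose compensator is
    bounded on the horizon. *)
Lemma stopped_exponential_moment (a : R) n T :
  P.-integrable setT (EFin \o (fun w => expR (a * X (rounded T n w) w))) /\
  \int[P]_w expR (a * X (rounded T n w) w) <=
    expR (`|exponent nu sigma a| * T%:R + a * x).
Proof.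
set psi := exponent nu sigma a.
have kh0 (k : nat) : 0 <= k%:R * mesh n :> R by rewrite mulr_ge0// ltW// mesh_gt0.
have iX := integrable_stopped (@decA n) (mA n)
  (fun k => integrable_expR hF hB nu sigma x a (kh0 k)) (T * n.+1)%N.
split => //.
pose Y (k : nat) w := expR (- psi * (k%:R * mesh n)) * expR (a * X (k%:R * mesh n) w).
have iY k : P.-integrable setT (EFin \o Y k).
  exact: (integrableZl measurableT _ (integrable_expR hF hB nu sigma x a (kh0 k))).
have iYN := integrable_stopped (@decA n) (mA n) iY (T * n.+1)%N.
have mart : forall k, \int[P]_(w in reached tau n k) Y k.+1 w =
    \int[P]_(w in reached tau n k) Y k w.
  move=> k; have iE l := integrableS measurableT (mA n k) (@subsetT _ _)
    (integrable_expR hF hB nu sigma x a (kh0 l)).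
  rewrite /Y !RintegralZl//.
  have kk : k%:R * mesh n <= k.+1%:R * mesh n :> R by rewrite ler_pM2r ?mesh_gt0// ler_nat.
  rewrite {1}/Rintegral (exponential_martingale hF hB _ _ _ _ (kh0 k) kk (FA n k)).
  rewrite fineM//; last exact: (integrable_fin_num (mA n k) (iE k)).
  rewrite mulrCA mulrC [X in X * _]/= -expRD -/psi; congr (expR _ * _).
  by rewrite -natr1; ring.
have YE : \int[P]_w Y (steps n (T * n.+1)%N w) w = expR (a * x).
  rewrite (Rintegral_stopped_martingale (@decA n) (mA n) iY _ mart).
  rewrite /Y mul0r mulr0 expR0 /Rintegral.
  under eq_integral do rewrite mul1r.
  by rewrite (exponential_moment hF hB)// mulr0 addr0.
rewrite expRD -YE -RintegralZl//; apply: le_Rintegral => //.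
- exact: (integrableZl measurableT _ iYN).
- move=> w _; have pr : psi * rounded T n w <= `|psi| * T%:R.
    rewrite (le_trans (ler_norm _))// normrM (ger0_norm (rounded_ge0 _ _ _ _)).
    by rewrite ler_wpM2l// rounded_le.
  rewrite /Y -/(rounded T n w) mulrA -expRD -[leLHS]mul1r ler_wpM2r ?expR_ge0//.
  by rewrite -[leLHS]expR0 ler_expR mulNr subr_ge0.
Qed.

Variables (c xi : R).
Hypotheses (c0 : 0 <= c) (lam0 : lam <= 0).
Hypothesis continuation_valueE : forall y,
  continuation_value y = c * (expR (lam * (y - xi)) - 1 - lam * (y - xi)).

Lemma continuation_value_ge0 y : 0 <= continuation_value y.
Proof.
by rewrite continuation_valueE mulr_ge0//; have := expR_ge1Dx (lam * (y - xi)); lra.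
Qed.

Lemma continuation_value_boundary : continuation_value xi = 0.
Proof. by rewrite continuation_valueE !subrr mulr0 expR0 subrr subr0 mulr0. Qed.

Lemma continuation_value_le y : xi <= y ->
  continuation_value y <= c * - lam * (`|y| + `|xi|).
Proof.
move=> xiy; rewrite continuation_valueE -mulrA ler_wpM2l//.
have h1 : expR (lam * (y - xi)) <= 1.
  by rewrite -[leRHS]expR0 ler_expR mulr_le0_ge0// subr_ge0.
have h2 : - lam * (y - xi) <= - lam * (`|y| + `|xi|).
  rewrite ler_wpM2l ?oppr_ge0// lerD ?ler_norm//.
  by rewrite -normrN ler_norm.
by move: h2; rewrite !mulNr; lra.
Qed.

Definition square_bound := 2 * c ^+ 2 *
  (expR (2 * lam * xi) + expR (- (2 * lam * xi))).

Lemma continuation_value_sqr_le y : continuation_value y ^+ 2 <=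
  square_bound * (expR (2 * lam * y) + expR (- (2 * lam) * y)).
Proof.
set u := lam * (y - xi).
have e1 := expR_gt0 u; have e2 := expR_gt0 (- u).
have h1 := expR_ge1Dx u; have h2 := expR_ge1Dx (- u).
have hh : continuation_value y <= c * (expR u + expR (- u)).
  by rewrite continuation_valueE -/u ler_wpM2l//; lra.
have h0 := continuation_value_ge0 y.
have sq : continuation_value y ^+ 2 <= (c * (expR u + expR (- u))) ^+ 2.
  by rewrite ler_sqr ?nnegrE// (le_trans h0).
have eu : expR u ^+ 2 = expR (2 * lam * y) * expR (- (2 * lam * xi)).
  by rewrite -expRM_natl -expRD; congr expR; rewrite /u; ring.
have eNu : expR (- u) ^+ 2 = expR (- (2 * lam) * y) * expR (2 * lam * xi).
  by rewrite -expRM_natl -expRD; congr expR; rewrite /u; ring.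
apply: (le_trans sq); rewrite exprMn.
have h3 : (expR u + expR (- u)) ^+ 2 <= 2 * (expR u ^+ 2 + expR (- u) ^+ 2).
  by have := sqr_ge0 (expR u - expR (- u)); nra.
apply: (le_trans (ler_wpM2l (sqr_ge0 c) h3)); rewrite eu eNu /square_bound.
set p := expR (2 * lam * y); set p' := expR (- (2 * lam) * y).
set q := expR (2 * lam * xi); set q' := expR (- (2 * lam * xi)).
have -> : c ^+ 2 * (2 * (p * q' + p' * q)) = 2 * c ^+ 2 * (p * q' + p' * q) by ring.
rewrite -[leRHS]mulrA ler_wpM2l ?mulr_ge0 ?sqr_ge0//.
have pq : 0 <= p * q by rewrite mulr_ge0 ?expR_ge0.
have pq' : 0 <= p' * q' by rewrite mulr_ge0 ?expR_ge0.
nra.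
Qed.

Let Z (T n : nat) w := value_process (rounded T n w) w.

Lemma integrable_Z T n : P.-integrable setT (EFin \o Z T n).
Proof.
apply: (integrable_stopped (@decA n) (mA n) (Y := fun k => value_process (k%:R * mesh n))).
move=> k; apply: (integrable_value_process hF hB alpha0 C lamE x).
by rewrite mulr_ge0// ltW// mesh_gt0.
Qed.

Definition second_moment_bound (T : nat) : R := square_bound *
  (expR (`|exponent nu sigma (2 * lam)| * T%:R + 2 * lam * x) +
   expR (`|exponent nu sigma (- (2 * lam))| * T%:R + - (2 * lam) * x)).

(** Uniform integrability in the mesh: second moments are bounded on a bounded
    horizon, so truncating costs a term of order [1 / K]. *)
Lemma mean_truncation T n K : 0 < K ->
  \int[P]_w Z T n w <= \int[P]_w Num.min (Z T n w) K + second_moment_bound T / K.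
Proof.
move=> K0; have iZ := integrable_Z T n.
have mZ : measurable_fun setT (Z T n) by apply/measurable_EFinP; exact: measurable_int iZ.
have [ip mp] := stopped_exponential_moment (2 * lam) n T.
have [im mm] := stopped_exponential_moment (- (2 * lam)) n T.
have Z0 w : 0 <= Z T n w by rewrite mulr_ge0 ?expR_ge0 ?continuation_value_ge0.
have imin : P.-integrable setT (EFin \o (fun w => Num.min (Z T n w) K)).
  apply: le_integrable iZ => //.
    by apply/measurable_EFinP; apply: measurable_minr.
  move=> w _ /=; rewrite lee_fin !ger0_norm ?ge_min ?lexx//.
  by rewrite le_min Z0 ltW.
have ipm := integrableD measurableT ip im.
have isq : P.-integrable setT (EFin \o (fun w => square_bound / K *
   (expR (2 * lam * X (rounded T n w) w) + expR (- (2 * lam) * X (rounded T n w) w)))).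
  exact: (integrableZl measurableT _ ipm).
apply: (@le_trans _ _ (\int[P]_w (Num.min (Z T n w) K + square_bound / K *
   (expR (2 * lam * X (rounded T n w) w) + expR (- (2 * lam) * X (rounded T n w) w))))).
  apply: le_Rintegral => //.
    exact: (integrableD measurableT imin isq).
  move=> w _; apply: (le_trans (ler_min_sqr K0 (Z0 w))); rewrite lerD2l.
  rewrite [leRHS]mulrAC ler_pM2r ?invr_gt0//.
  apply: le_trans (continuation_value_sqr_le _).
  rewrite /Z /value_process exprMn ler_piMl ?sqr_ge0//.
  rewrite expr_le1 ?expR_ge0// -[leRHS]expR0 ler_expR oppr_le0 mulr_ge0 ?(ltW alpha0)//.
  exact: rounded_ge0.
rewrite RintegralD// lerD2l RintegralZl// RintegralD//.
rewrite /second_moment_bound [leLHS]mulrAC ler_pM2r ?invr_gt0// ler_wpM2l//.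
  by rewrite mulr_ge0 ?mulr_ge0 ?sqr_ge0 ?addr_ge0 ?expR_ge0.
exact: lerD.
Qed.

(* All that is used of the entrance rule: the paths stay in the closed
   half-line until it and are at its boundary when it occurs. *)
Hypothesis stay : forall w t, B 0 w = 0 -> 0 <= t -> (t%:E <= tau w)%E -> xi <= X t w.
Hypothesis exit : forall w t, B 0 w = 0 -> tau w = t%:E -> X t w = xi.

Definition surviving (T : nat) : set Omega := [set w | (T%:R%:E <= tau w)%E].
(** The value still held at the horizon, zero on the paths already stopped. *)
Definition terminal (T : nat) : Omega -> R := value_process T%:R \_ (surviving T).

Lemma measurable_surviving T : measurable (surviving T).
Proof.
rewrite -[surviving T]setCK; apply: measurableC.
apply: (filtration_measurable hF (ler0n _ T)).
rewrite (_ : ~` _ = [set w | (tau w < T%:R%:E)%E]); first exact: otau.2.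
by apply/seteqP; split => w /=; rewrite /surviving/= ltNge => /negP.
Qed.

Lemma integrable_terminal T : P.-integrable setT (EFin \o terminal T).
Proof.
rewrite -restrict_EFin; apply/(integrable_mkcond _ (measurable_surviving T)).
apply: (integrableS measurableT (measurable_surviving T) (@subsetT _ _)).
exact: (integrable_value_process hF hB alpha0 C lamE x (ler0n _ T)).
Qed.

Lemma terminal_ge0 T w : 0 <= terminal T w.
Proof.
by rewrite /terminal patchE; case: ifPn => // _; rewrite mulr_ge0 ?expR_ge0 ?continuation_value_ge0.
Qed.

Lemma value_process_cvg (w : Omega) (u : R^nat) (l : R) : (forall n, 0 <= u n) -> 0 <= l ->
  u @ \oo --> l -> value_process (u n) w @[n --> \oo] --> value_process l w.
Proof.
move=> u0 l0 ul.
have Xu : X (u n) w @[n --> \oo] --> X l w.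
  apply: (within_continuous_cvg_seq (@drifted_continuous _ _ _ _ _ _ hB nu sigma x w) _ _ ul).
    by move=> n; rewrite /= in_itv/= andbT.
  by rewrite /= in_itv/= andbT.
have expc (f : R^nat) (m : R) : f @ \oo --> m -> expR (f n) @[n --> \oo] --> expR m.
  by move=> fm; apply: continuous_cvg => //; exact: continuous_expR.
apply: cvgM.
  by apply: expc; apply: cvgN; apply: cvgM => //; exact: cvg_cst.
apply: cvgD.
  by apply: cvgD; [apply: cvgM => //; exact: cvg_cst|exact: cvg_cst].
apply: cvgM; first exact: cvg_cst.
by apply: expc; apply: cvgM => //; exact: cvg_cst.
Qed.

(** The rounded times decrease to the stopping rule, where the value vanishes
    because it sits on the boundary; only the paths that survive the horizon
    keep a value. *)
Lemma Z_cvg T w : B 0 w = 0 -> Z T n w @[n --> \oo] --> terminal T w.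
Proof.
move=> B0; rewrite /terminal patchE; case: ifPn => wT.
  apply: value_process_cvg => //; first by move=> n; exact: rounded_ge0.
  by apply: (rounded_cvg otau) => //; right; split => //; exact: set_mem.
have : (tau w < T%:R%:E)%E by rewrite ltNge; apply/negP => h; move/negP: wT; apply; exact: mem_set.
move=> wT'; have : tau w \is a fin_num.
  by rewrite ge0_fin_numE ?otau.1// (lt_trans wT')// ltry.
move=> /fineK tauE; have f0 : 0 <= fine (tau w) by rewrite fine_ge0// otau.1.
have v0 : value_process (fine (tau w)) w = 0.
  by rewrite /value_process (exit B0)// continuation_value_boundary mulr0.
suff : Z T n w @[n --> \oo] --> value_process (fine (tau w)) w by rewrite v0.
apply: value_process_cvg => //; first by move=> n; exact: rounded_ge0.
apply: (rounded_cvg otau); first by left.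
by rewrite -lee_fin tauE ltW.
Qed.

Lemma truncated_mean_cvg T K : 0 < K ->
  \int[P]_w Num.min (Z T n w) K @[n --> \oo] --> \int[P]_w Num.min (terminal T w) K.
Proof.
move=> K0.
have mZ n : measurable_fun setT (Z T n).
  by apply/measurable_EFinP; exact: measurable_int (integrable_Z T n).
have mt : measurable_fun setT (terminal T).
  by apply/measurable_EFinP; exact: measurable_int (integrable_terminal T).
have := @dominated_convergence _ _ _ P setT measurableT
  (fun n w => (Num.min (Z T n w) K)%:E) (fun w => (Num.min (terminal T w) K)%:E) (cst K%:E).
case => //.
- by move=> n; apply/measurable_EFinP; apply: measurable_minr.
- by apply/measurable_EFinP; apply: measurable_minr.
- have := brownian_start hB; apply: filterS => w B0 _.
  apply: cvg_EFin; first exact: nearW.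
  have Zw := @Z_cvg T w B0.
  rewrite minr_absE; under eq_fun do rewrite minr_absE.
  apply: cvgM; last exact: cvg_cst.
  apply: cvgB; first by apply: cvgD => //; exact: cvg_cst.
  by apply: cvg_norm; apply: cvgB => //; exact: cvg_cst.
- exact: finite_measure_integrable_cst.
- apply: aeW => w n _; rewrite /= lee_fin ger0_norm ?ge_min ?lexx ?orbT//.
  by rewrite le_min (ltW K0) andbT mulr_ge0 ?expR_ge0 ?continuation_value_ge0.
- move=> i _ H; apply: fine_cvg; rewrite fineK//.
  exact: (integrable_fin_num measurableT i).
Qed.

(** With truncated values the mesh goes to zero by dominated
    convergence, and the truncation level is then taken large. *)
Lemma terminal_limit T :
  continuation_value x - area (capped_region tau T) <= \int[P]_w terminal T w.
Proof.
apply/ler_addgt0Pr => e e0.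
pose M := second_moment_bound T.
have M0 : 0 <= M.
  by rewrite !mulr_ge0 ?sqr_ge0 ?addr_ge0 ?expR_ge0.
pose K := (M + 1) / e.
have K0 : 0 < K by rewrite divr_gt0//; lra.
have MK : M / K <= e.
  by rewrite ler_pdivrMr// /K mulrCA divff ?gt_eqF// mulr1 lerDl.
have h1 : (fun n => continuation_value x - area (grid n T)) @ \oo -->
    continuation_value x - area (capped_region tau T).
  by apply: cvgB; [exact: cvg_cst|exact: grid_area_cvg].
have h2 : (fun n => \int[P]_w Num.min (Z T n w) K + M / K) @ \oo -->
    \int[P]_w Num.min (terminal T w) K + M / K.
  by apply: cvgD; [exact: truncated_mean_cvg|exact: cvg_cst].
apply: (@le_trans _ _ (\int[P]_w Num.min (terminal T w) K + M / K)).
  apply: (ler_cvg_to h1 h2); near=> n.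
  by rewrite -(grid_areaE n T) addrC addKr; exact: mean_truncation.
apply: lerD => //; apply: le_Rintegral => //.
- apply: le_integrable (integrable_terminal T) => //.
    apply/measurable_EFinP; apply: measurable_minr => //.
    by apply/measurable_EFinP; exact: measurable_int (integrable_terminal T).
  move=> w _ /=; have t0 := terminal_ge0 T w.
  by rewrite lee_fin !ger0_norm ?ge_min ?lexx// le_min t0 ltW.
- exact: integrable_terminal.
- by move=> w _; rewrite ge_min lexx.
Unshelve. all: by end_near. Qed.

Definition terminal_bound := c * - lam * (gain_bound alpha nu sigma x + `|xi|).

(** The surviving paths are in the half-line, where the value grows linearly,
    while the mean size of the motion grows at most like
    [expR (alpha * T / 2)]. *)
Lemma mean_terminal T :
  \int[P]_w terminal T w <= terminal_bound * expR (- (alpha / 2)) ^+ T.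
Proof.
have cl : 0 <= c * - lam by rewrite mulr_ge0// oppr_ge0.
have mX : measurable_fun setT (X T%:R) by exact: (drifted_measurable hF hB).
rewrite -lee_fin fineK; last exact: (integrable_fin_num measurableT (integrable_terminal T)).
apply: (@le_trans _ _ (\int[P]_w ((expR (- (alpha * T%:R)) * (c * - lam))%:E *
   (`|X T%:R w|%:E + `|xi|%:E)))%E).
  apply: ae_ge0_le_integral => //.
  - by move=> w _; rewrite lee_fin terminal_ge0.
  - exact: measurable_int (integrable_terminal T).
  - by move=> w _; rewrite -EFinD -EFinM lee_fin !mulr_ge0 ?expR_ge0 ?addr_ge0 ?oppr_ge0.
  - apply/measurable_EFinP; apply: measurable_funM => //; apply: measurable_funD => //.
    exact: measurableT_comp.
  - have := brownian_start hB; apply: filterS => w B0 _.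
    rewrite -EFinD -EFinM lee_fin /terminal patchE; case: ifPn => [wT|_].
      rewrite /value_process -mulrA ler_wpM2l ?expR_ge0// continuation_value_le//.
      by apply: stay => //; exact: set_mem wT.
    by rewrite !mulr_ge0 ?expR_ge0 ?addr_ge0 ?oppr_ge0.
rewrite ge0_integralZl//; last 3 first.
- apply/measurable_EFinP; apply: measurable_funD => //; exact: measurableT_comp.
- by move=> w _; rewrite -EFinD lee_fin addr_ge0.
- by rewrite lee_fin mulr_ge0 ?expR_ge0.
rewrite ge0_integralD//; last by apply/measurable_EFinP; exact: measurableT_comp.
rewrite integral_cst//= [X in (_ * (_ + _ * X))%E]probability_setT mule1.
have h := mean_norm_drifted hF hB nu sigma alpha0 x (ler0n R T).
apply: (@le_trans _ _ ((expR (- (alpha * T%:R)) * (c * - lam))%:E *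
  ((gain_bound alpha nu sigma x * expR (alpha / 2 * T%:R))%:E + `|xi|%:E))%E).
  by apply: lee_wpmul2l; [rewrite lee_fin mulr_ge0 ?expR_ge0|apply: leeD].
rewrite -EFinD -EFinM lee_fin -expRM_natl.
have e1 : 1 <= expR (alpha / 2 * T%:R).
  by rewrite -[leLHS]expR0 ler_expR mulr_ge0// divr_ge0// ltW.
have ee : expR (- (alpha * T%:R)) * expR (alpha / 2 * T%:R) = expR (T%:R * - (alpha / 2)).
  by rewrite -expRD; congr expR; field.
rewrite -ee /terminal_bound; set p := expR (- (alpha * T%:R)).
set q := expR (alpha / 2 * T%:R) in e1 *; set g := gain_bound _ _ _ _.
have -> : p * (c * - lam) * (g * q + `|xi|) = c * - lam * (p * (g * q + `|xi|)) by ring.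
rewrite -[leRHS]mulrA ler_wpM2l//.
have -> : (g + `|xi|) * (p * q) = p * (g * q + `|xi| * q) by ring.
by rewrite ler_wpM2l ?expR_ge0// lerD2l ler_peMr.
Qed.

Lemma continuation_value_le_area : continuation_value x <= area (stopped_region tau).
Proof.
rewrite -subr_le0.
have h1 : (fun T => continuation_value x - area (capped_region tau T)) @ \oo -->
    continuation_value x - area (stopped_region tau).
  by apply: cvgB; [exact: cvg_cst|exact: capped_area_cvg].
have h2 : (fun T => terminal_bound * expR (- (alpha / 2)) ^+ T) @ \oo --> (0 : R).
  rewrite -(mulr0 terminal_bound); apply: cvgM; first exact: cvg_cst.
  apply: cvg_expr; rewrite ger0_norm ?expR_ge0// -[ltRHS]expR0 ltr_expR oppr_lt0.
  by rewrite divr_gt0.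
apply: (ler_cvg_to h1 h2); near=> T.
exact: (le_trans (terminal_limit T) (mean_terminal T)).
Unshelve. all: by end_near. Qed.

End verification.

(** * Entrance times of a half-line *)

Section entrance_times.
Context {R : realType} {d : measure_display} {Omega : measurableType d}.
Variables (P : probability Omega R) (F : R -> set (set Omega)) (B : R -> Omega -> R).
Hypotheses (hF : is_filtration F) (hB : is_brownian_motion P F B).
Variables (nu sigma x xi : R).
Local Notation X := (drifted_brownian_motion nu sigma B x).
Local Notation past t := (g_sigma_algebraType (F t)).

Let cX (w : Omega) : {within `[0, +oo[%classic, continuous (X ^~ w)}.
Proof. exact: (@drifted_continuous _ _ _ _ _ _ hB nu sigma x w). Qed.

(** The points dividing [a, b] into [n + 1] equal parts; an index past the end
    stands for [b], so that every natural number names a point. *)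
Definition division (a b : R) (n k : nat) : R :=
  a + (b - a) * ((minn k n.+1)%:R / n.+1%:R).

Lemma division_itv a b n k : a <= b -> a <= division a b n k <= b.
Proof.
move=> ab; rewrite /division; set u := _ / _.
have u0 : 0 <= u by rewrite divr_ge0.
have u1 : u <= 1 by rewrite ler_pdivrMr// mul1r ler_nat geq_minr.
by apply/andP; split; nra.
Qed.

Lemma division_cvg (a b s : R) : a <= s <= b ->
  exists k : nat -> nat, division a b n (k n) @[n --> \oo] --> s.
Proof.
move=> /andP[as_ sb]; have ab := le_trans as_ sb.
have [ba|ba] := eqVneq b a.
  exists (fun=> 0%N); have -> : s = a by apply/eqP; rewrite eq_le as_ -ba sb.
  rewrite (_ : (fun _ => _) = fun=> a); first exact: cvg_cst.
  by apply/funext => n; rewrite /division ba subrr mul0r addr0.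
have ab0 : 0 < b - a by rewrite subr_gt0 lt_neqAle eq_sym ba.
pose u := (s - a) / (b - a).
have u0 : 0 <= u by rewrite divr_ge0 ?subr_ge0// ltW.
have u1 : u <= 1 by rewrite ler_pdivrMr// mul1r lerD2r.
exists (fun n => Num.truncn (u * n.+1%:R)).
have sE : s = a + (b - a) * u by rewrite /u; field; rewrite gt_eqF.
rewrite [X in _ --> X]sE; apply: cvgD; first exact: cvg_cst.
apply: cvgM; first exact: cvg_cst.
apply: (@squeeze_cvgr _ _ _ _ (fun n => u - n.+1%:R^-1) (fun=> u)).
- near=> n; have un : 0 <= u * n.+1%:R by rewrite mulr_ge0.
  have /andP[h1 h2] := truncn_itv un.
  have le : (Num.truncn (u * n.+1%:R) <= n.+1)%N.
    by rewrite -(ler_nat R) (le_trans h1)// ler_piMl.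
  rewrite (minn_idPl le); apply/andP; split.
    by rewrite lerBlDr -[X in _ + X]mul1r -mulrDl ler_pdivlMr// natr1 ltW.
  by rewrite ler_pdivrMr.
- rewrite -[X in _ --> X]subr0; apply: cvgB; first exact: cvg_cst.
  exact: cvg_harmonic.
- exact: cvg_cst.
Unshelve. all: by end_near. Qed.

(** Continuity of the paths makes the uncountable union over the times of [a, b]
    an event of the past: reaching the closed half-line amounts to coming
    arbitrarily close to it at division points, by compactness of [a, b]. *)
Lemma reach_past (a b : R) : 0 <= a -> a <= b ->
  F b [set w | exists s, [/\ a <= s, s <= b & X s w <= xi]].
Proof.
move=> a0 ab; have b0 := le_trans a0 ab; rewrite -(past_measurableE hF _ b0).
rewrite (_ : [set w | _] = \bigcap_m \bigcup_n \bigcup_k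
    [set w | X (division a b n k) w < xi + m.+1%:R^-1]).
  apply: bigcapT_measurable => m; apply: bigcupT_measurable => n.
  apply: bigcupT_measurable => k; have /andP[d1 d2] := division_itv n k ab.
  have := drifted_past_measurable hF hB nu sigma x (le_trans a0 d1) d2 measurableT
    (measurable_itv `]-oo, (xi + m.+1%:R^-1)[).
  by rewrite setTI; congr measurable; apply/seteqP; split => w /=; rewrite in_itv.
apply/seteqP; split => [w [s [as_ sb Xs]] m _|w H].
  have /division_cvg[k kcv] : a <= s <= b by rewrite as_.
  have Xk : X (division a b n (k n)) w @[n --> \oo] --> X s w.
    apply: (within_continuous_cvg_seq (@cX w) _ _ kcv).
      move=> n; rewrite /= in_itv/= andbT.
      by have /andP[d1 _] := division_itv n (k n) ab; exact: le_trans a0 d1.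
    by rewrite /= in_itv/= andbT (le_trans a0).
  have : X s w < xi + m.+1%:R^-1 by rewrite (le_lt_trans Xs)// ltrDl.
  move=> /(cvgr_lt _ Xk)[n _ /(_ n (leqnn n)) Hn].
  by exists n => //; exists (k n).
have cab : {within `[a, b], continuous (X ^~ w)}.
  apply: continuous_subspaceW (@cX w) => s /=; rewrite !in_itv/= andbT => /andP[as_ _].
  exact: le_trans a0 as_.
have [s] := EVT_min ab cab; rewrite in_itv/= => /andP[as_ sb] smin.
exists s; split => //; apply/ler_addgt0Pr => e e0.
have := @cvg_harmonic R => /cvgr_lt/(_ _ e0)[m _ /(_ m (leqnn m)) /= me].
have [n _ [k _ /= Xk]] := H m I.
have dab : division a b n k \in `[a, b] by rewrite in_itv/= division_itv.
rewrite (le_trans (smin _ dab))// (le_trans (ltW Xk))// lerD2l.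
exact: ltW.
Qed.

Variable Q : set R.
Hypotheses (Q0 : forall t, Q t -> 0 <= t) (Q1 : forall t, 0 < t -> Q t).

(** [Q] is the set of admissible times: all times [t >= 0] give the hitting time
    of the closed half-line, times [t > 0] the exit time of its complement. *)
Definition entrance_time (w : Omega) : \bar R :=
  ereal_inf [set t%:E | t in [set t : R | Q t /\ X t w <= xi]].

Lemma entrance_time_ge0 w : (0 <= entrance_time w)%E.
Proof. by apply/ereal_infP => _ [t [/Q0 t0 _] <-]; rewrite lee_fin. Qed.

Lemma entrance_time_le t w : Q t -> X t w <= xi -> (entrance_time w <= t%:E)%E.
Proof. by move=> Qt Xt; apply: ereal_inf_lbound; exists t. Qed.

(** By continuity a path strictly inside at time [t] stays inside for a
    while. *)
Lemma entrance_time_gt t w : 0 <= t -> (t%:E <= entrance_time w)%E ->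
  xi < X t w -> (t%:E < entrance_time w)%E.
Proof.
move=> t0 tw Xt; have /subspace_continuousP cw := @cX w.
have tT : `[0, +oo[%classic t by rewrite /= in_itv/= andbT.
have := cw _ tT => /cvgr_gt/(_ _ Xt); rewrite near_withinE => /nbhs_ballP[e /= e0 He].
apply: (@lt_le_trans _ _ (t + e)%:E); first by rewrite lte_fin ltrDl.
apply/ereal_infP => _ [s [Qs Xs] <-]; rewrite lee_fin leNgt; apply/negP => ste.
have ts : t <= s.
  by rewrite -lee_fin (le_trans tw)// entrance_time_le.
have : xi < X s w.
  apply: He; last by rewrite /= in_itv/= andbT Q0.
  by rewrite /ball/= distrC ger0_norm ?subr_ge0// ltrBlDr addrC.
by rewrite ltNge Xs.
Qed.

Hypothesis x_xi : xi <= x.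

Lemma entrance_time_stay w t : B 0 w = 0 -> 0 <= t ->
  (t%:E <= entrance_time w)%E -> xi <= X t w.
Proof.
move=> B0; rewrite le_eqVlt => /predU1P[<- _|t0 tw].
  by rewrite /drifted_brownian_motion B0 !mulr0 !addr0.
have early s : 0 < s -> s < t -> xi <= X s w.
  move=> s0 st; rewrite leNgt; apply/negP => /ltW Xs.
  have := le_trans tw (entrance_time_le (Q1 s0) Xs).
  by rewrite lee_fin leNgt st.
pose u n := t - t * n.+2%:R^-1.
have i0 n : 0 < n.+2%:R^-1 :> R by rewrite invr_gt0.
have i1 n : n.+2%:R^-1 < 1 :> R by rewrite invf_lt1// ltr1n.
have u0 n : 0 < u n by rewrite subr_gt0 gtr_pMr.
have ut n : u n < t by rewrite ltrBlDr ltrDl mulr_gt0.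
have ucv : u @ \oo --> t.
  rewrite -[X in _ --> X]subr0 -(mulr0 t); apply: cvgB; first exact: cvg_cst.
  apply: cvgM; first exact: cvg_cst.
  by rewrite (cvg_shiftS (fun n => (n.+1%:R^-1 : R))); exact: cvg_harmonic.
have Xu : X (u n) w @[n --> \oo] --> X t w.
  apply: (within_continuous_cvg_seq (@cX w) _ _ ucv).
    by move=> n; rewrite /= in_itv/= andbT ltW.
  by rewrite /= in_itv/= andbT ltW.
by apply: (cvgr_to_ge Xu); near=> n; exact: early.
Unshelve. all: by end_near. Qed.

Lemma entrance_time_exit w t : B 0 w = 0 -> entrance_time w = t%:E -> X t w = xi.
Proof.
move=> B0 wt; have t0 : 0 <= t by rewrite -lee_fin -wt entrance_time_ge0.
apply/eqP; rewrite eq_le entrance_time_stay ?wt// andbT leNgt; apply/negP => Xt.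
have : (t%:E < entrance_time w)%E by apply: entrance_time_gt; rewrite ?wt.
by rewrite wt ltxx.
Qed.

End entrance_times.

Section hitting_times.
Context {R : realType} {d : measure_display} {Omega : measurableType d}.
Variables (P : probability Omega R) (F : R -> set (set Omega)) (B : R -> Omega -> R).
Hypotheses (hF : is_filtration F) (hB : is_brownian_motion P F B).
Variables (nu sigma x xi : R).
Local Notation X := (drifted_brownian_motion nu sigma B x).

(** The infimum of the hitting times is attained, so it is at most [t] exactly
    when the half-line is reached on [0, t]. *)
Lemma hitting_time_stopping :
  stopping_times F (entrance_time B nu sigma x xi [set t | 0 <= t]).
Proof.
have Q0 t : [set t : R | 0 <= t] t -> 0 <= t by [].
split; first by move=> w; exact: entrance_time_ge0.
move=> t t0.
rewrite (_ : [set w | _] = [set w | exists s, [/\ 0 <= s, s <= t & X s w <= xi]]).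
  exact: (reach_past hF hB).
apply/seteqP; split => [w /= wt|w /= [s [s0 st Xs]]]; last first.
  by apply: (@le_trans _ _ s%:E); [exact: entrance_time_le|rewrite lee_fin].
apply: contrapT => none.
have never s : 0 <= s -> s <= t -> xi < X s w.
  by move=> s0 st; rewrite ltNge; apply/negP => Xs; apply: none; exists s.
move: wt; apply/negP; rewrite -ltNge.
apply: (entrance_time_gt hB Q0) => //; last exact: never.
apply/ereal_infP => _ [s [s0 Xs] <-]; rewrite lee_fin leNgt; apply/negP => st.
by have := never s s0 (ltW st); rewrite ltNge Xs.
Qed.

(** Reaching the half-line strictly between [0] and [t] means reaching it on one
    of the closed intervals exhausting that open interval. *)
Lemma entrance_time_optional :
  optional_time F (entrance_time B nu sigma x xi [set t | 0 < t]).
Proof.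
split; first by move=> w; apply: entrance_time_ge0 => t /ltW.
move=> t t0; rewrite -(past_measurableE hF _ t0).
pose e n : R := n.+2%:R^-1.
have e0 n : 0 < e n by rewrite invr_gt0.
have e1 n : e n <= 1 / 2.
  by rewrite div1r lef_pV2 ?posrE// ler_nat.
rewrite (_ : [set w | _] = \bigcup_n [set w | exists s,
    [/\ t * e n <= s, s <= t - t * e n & 0 < t /\ X s w <= xi]]).
  apply: bigcupT_measurable => n; move: t0; rewrite le_eqVlt => /predU1P[<-|t0].
    rewrite (_ : [set w | _] = set0)//; apply/seteqP; split => // w [s [_ _ []]].
    by rewrite ltxx.
  have h1 : 0 <= t * e n by rewrite mulr_ge0 ?ltW.
  have h2 : t * e n <= t - t * e n by have := e1 n; nra.
  have h3 : t - t * e n <= t by rewrite lerBlDr lerDl.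
  rewrite (past_measurableE hF _ (ltW t0)).
  apply: (filtration_monotone hF (le_trans h1 h2) h3).
  have := reach_past hF hB nu sigma x xi h1 h2; congr (F _); apply/seteqP.
  by split => w [s [? ? h]]; exists s; split => //; case: h.
apply/seteqP; split => [w /ereal_inf_ltP[_ [s [s0 Xs] <-]]|].
  rewrite lte_fin => st; have t1 : 0 < t := lt_trans s0 st.
  pose m := Num.min (s / t) (1 - s / t).
  have m0 : 0 < m.
    by rewrite lt_min divr_gt0//= subr_gt0 ltr_pdivrMr// mul1r.
  have [n nm] : exists n, e n < m.
    have := @cvg_harmonic R => /cvgr_lt/(_ _ m0)[n _ /(_ n.+1 (leqnSn n)) Hn].
    by exists n.
  move: nm; rewrite lt_min => /andP[n1 n2].
  exists n => //; exists s; split => //.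
    by rewrite mulrC -ler_pdivlMr// ltW.
  rewrite lerBrDr -lerBrDl mulrC -ler_pdivlMr//.
  by rewrite (le_trans (ltW n2))// mulrBl divff ?gt_eqF.
move=> w [n _ [s [ts st [t1 Xs]]]]; apply/ereal_inf_ltP; exists s%:E.
  by exists s => //; split => //; rewrite /= (lt_le_trans _ ts)// mulr_gt0.
by rewrite lte_fin (le_lt_trans st)// ltrBlDr ltrDl mulr_gt0.
Qed.

Lemma entrance_time_immediate w : x < xi -> B 0 w = 0 ->
  entrance_time B nu sigma x xi [set t | 0 < t] w = 0%E.
Proof.
move=> xxi B0; apply/eqP; rewrite eq_le entrance_time_ge0 ?andbT; last by move=> t /ltW.
have /subspace_continuousP cw := @drifted_continuous _ _ _ _ _ _ hB nu sigma x w.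
have T0 : `[0, +oo[%classic (0 : R) by rewrite /= in_itv/= lexx.
have X0 : X 0 w < xi by rewrite /drifted_brownian_motion B0 !mulr0 !addr0.
have := cw _ T0 => /cvgr_lt/(_ _ X0); rewrite near_withinE => /nbhs_ballP[e /= e0 He].
apply/lee_addgt0Pr => z z0; rewrite add0e.
pose s := Num.min z (e / 2).
have s0 : 0 < s by rewrite lt_min z0 divr_gt0.
apply: (@le_trans _ _ s%:E); last by rewrite lee_fin ge_min lexx.
apply: entrance_time_le => //; apply: ltW; apply: He.
  rewrite /ball/= sub0r normrN gtr0_norm// gt_min orbC.
  by rewrite ltr_pdivrMr// ltr_pMr// ltr1n.
by rewrite /= in_itv/= andbT ltW.
Qed.

Lemma exit_time_entrance :
  exit_time (X : R -> Omega -> R) [set y | xi < y] =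
  entrance_time B nu sigma x xi [set t | 0 < t].
Proof.
apply/funext => w; congr ereal_inf; congr image; apply/seteqP; split => t /= [t0].
  by move/negP; rewrite -leNgt.
by move=> Xt; split => //; apply/negP; rewrite -leNgt.
Qed.

End hitting_times.

(** * The free boundary *)

Section returns.
Context {R : realType} {d : measure_display} {Omega : measurableType d}.
Variables (P : probability Omega R) (F : R -> set (set Omega)) (B : R -> Omega -> R).
Hypotheses (hF : is_filtration F) (hB : is_brownian_motion P F B).
Variables (alpha nu sigma : R).
Hypotheses (alpha0 : 0 < alpha).
Local Notation mu := (@lebesgue_measure R).
Local Notation TR := (measurableTypeR R).
Local Notation X := (drifted_brownian_motion nu sigma B).

Lemma optional_returnE (x : R) tau : optional_time F tau ->
  discounted_return alpha P (X x) tau =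
  (\int[(P \x mu)%E]_(z in stopped_region tau) gain B alpha nu sigma x z)%:E.
Proof.
move=> otau.
exact: (discounted_return_region hF hB nu sigma alpha0 x (measurable_stopped hF otau)).
Qed.

(** The same rule earns more from a higher starting point, because the paths
    are translates of each other. *)
Lemma discounted_return_mono (x y : R) tau : optional_time F tau -> x <= y ->
  (discounted_return alpha P (X x) tau <= discounted_return alpha P (X y) tau)%E.
Proof.
move=> otau xy; rewrite !optional_returnE// lee_fin.
have mS := measurable_stopped hF otau.
have iS z : (P \x mu)%E.-integrable (stopped_region tau) (EFin \o gain B alpha nu sigma z).
  apply: (integrableS measurable_nonneg_times mS (@stopped_region_sub _ _ _ _)).
  exact: (integrable_gain hF hB nu sigma alpha0 z).
apply: le_Rintegral => // z _; rewrite /gain ler_wpM2r ?expR_ge0//.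
by rewrite /drifted_brownian_motion -!addrA lerD2r.
Qed.

(** The Brownian motion starts at zero only almost surely, so the region below
    the graph of the rule is a time slice up to a null set of paths. *)
Lemma immediate_return (x : R) tau : optional_time F tau ->
  (forall w, B 0 w = 0 -> tau w = 0%E) ->
  discounted_return alpha P (X x) tau = 0%E.
Proof.
move=> otau tau0; rewrite optional_returnE//; congr (_%:E).
have mS := measurable_stopped hF otau.
pose N := [set w | B 0 w = 0].
have mN : measurable N.
  have := brownian_measurable hF hB (lexx 0) measurableT (measurable_set1 (0 : R)).
  by rewrite setTI.
have PN : P (~` N) = 0%E.
  by apply/negligibleP; [exact: measurableC|exact: (brownian_start hB)].
pose S0 : set (Omega * TR) := setT `*` [set 0].
pose S1 : set (Omega * TR) := ~` N `*` setT.
have mS0 : measurable S0 by apply: measurableX => //; exact: measurable_set1.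
have mS1 : measurable S1 by apply: measurableX => //; exact: measurableC.
have S01 : stopped_region tau `<=` S0 `|` S1.
  move=> [w t] [/= t0 tw]; have [wN|wN] := pselect (N w); last by right.
  left; split => //=; apply/eqP; rewrite eq_le t0 andbT.
  by move: tw; rewrite tau0// lee_fin.
rewrite /Rintegral null_set_integral//.
  apply: measurable_funTS; apply/measurable_EFinP.
  exact: (measurable_gain hF hB).
apply/eqP; rewrite eq_le measure_ge0 andbT.
apply: (@le_trans _ _ ((P \x mu)%E (S0 `|` S1))).
  by apply: le_measure => //; rewrite inE//; exact: measurableU.
apply: (le_trans (measureU2 _ mS0 mS1)).
have e0 : (P \x mu)%E S0 = 0%E.
  by rewrite product_measure1E//= lebesgue_measure_set1 mule0.
have e1 : (P \x mu)%E S1 = 0%E.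
  by rewrite product_measure1E//=; [rewrite [X in (X * _)%E]PN mul0e|exact: measurableC].
by rewrite [X in (X + _)%E]e0 [X in (_ + X)%E]e1 adde0.
Qed.

End returns.

Section free_boundary.
Context {R : realType} (alpha nu sigma : R).
Hypotheses (alpha0 : 0 < alpha) (sigma0 : 0 < sigma).

(** In terms of the statement, [decay], [scale] and [boundary] are the rate in
    the exponential, its coefficient and [xi]; smooth fit at the boundary
    determines the last two from the first. *)
Definition discriminant_root := Num.sqrt (nu ^+ 2 + 2 * alpha * sigma ^+ 2).
Local Notation r := discriminant_root.
Definition decay := (- nu - r) / sigma ^+ 2.
Definition scale := (sigma ^+ 2 / alpha) / (nu + r).
Definition boundary := - (nu / alpha) - sigma ^+ 2 / (nu + r).

Lemma root_sqr : r ^+ 2 = nu ^+ 2 + 2 * alpha * sigma ^+ 2.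
Proof.
rewrite sqr_sqrtr// addr_ge0 ?sqr_ge0// mulr_ge0 ?sqr_ge0// mulr_ge0//.
exact: ltW.
Qed.

Lemma norm_lt_root : `|nu| < r.
Proof.
rewrite -(@ltr_pXn2r _ 2)// ?nnegrE ?sqrtr_ge0// root_sqr real_normK ?num_real//.
by rewrite ltrDl mulr_gt0 ?exprn_gt0// mulr_gt0.
Qed.

Lemma sum_gt0 : 0 < nu + r.
Proof. by have := norm_lt_root; have := ler_norm (- nu); rewrite normrN; lra. Qed.

Lemma diff_lt0 : nu - r < 0.
Proof. by have := norm_lt_root; have := ler_norm nu; lra. Qed.

Lemma boundaryE : boundary = sigma ^+ 2 / (nu - r).
Proof.
have h1 := gt_eqF sum_gt0; have h2 := lt_eqF diff_lt0; have h3 := gt_eqF alpha0.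
have : (nu + r) * (nu - r) = - (2 * alpha * sigma ^+ 2).
  by rewrite mulrC -subr_sqr root_sqr; ring.
move=> e; apply/eqP; rewrite -subr_eq0; apply/eqP.
have -> : boundary - sigma ^+ 2 / (nu - r) =
  - (nu / alpha) - (2 * nu * sigma ^+ 2) / ((nu + r) * (nu - r)).
  by rewrite /boundary; field; rewrite h1 h2 h3.
rewrite e; field; by rewrite h3 gt_eqF.
Qed.

Lemma boundary_lt0 : boundary < 0.
Proof.
by rewrite boundaryE pmulr_rlt0 ?exprn_gt0// invr_lt0 diff_lt0.
Qed.

Lemma decay_le0 : decay <= 0.
Proof.
rewrite /decay -opprD mulNr oppr_le0 divr_ge0 ?sqr_ge0//.
exact: ltW sum_gt0.
Qed.

Lemma scale_ge0 : 0 <= scale.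
Proof. by rewrite !divr_ge0 ?sqr_ge0 ?ltW ?sum_gt0. Qed.

(** The decay rate is the negative root of the characteristic equation
    [exponent lam = alpha]. *)
Lemma exponent_decay : exponent nu sigma decay = alpha.
Proof.
have s0 : sigma != 0 by rewrite gt_eqF.
have : 2 * sigma ^+ 2 * exponent nu sigma decay = r ^+ 2 - nu ^+ 2.
  by rewrite /exponent /decay; field.
rewrite root_sqr => e; have s2 : 2 * sigma ^+ 2 != 0 by rewrite mulf_neq0 ?expf_neq0// pnatr_eq0.
by apply: (mulfI s2); rewrite e; ring.
Qed.

Lemma scale_decay : scale * decay = - alpha^-1.
Proof.
rewrite /scale /decay; have h1 := gt_eqF sum_gt0.
by field; rewrite h1 !gt_eqF.
Qed.

(** Smooth fit: the boundary and the scale are such that the value and its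
    derivative vanish at the boundary. *)
Lemma continuation_value_smooth_fit (y : R) :
  continuation_value alpha nu decay (scale * expR (- decay * boundary)) y =
  scale * (expR (decay * (y - boundary)) - 1 - decay * (y - boundary)).
Proof.
have h1 := gt_eqF sum_gt0; have h3 := gt_eqF alpha0.
have -> : scale * (expR (decay * (y - boundary)) - 1 - decay * (y - boundary)) =
    scale * expR (decay * (y - boundary)) - scale - (scale * decay) * (y - boundary).
  by ring.
rewrite scale_decay /continuation_value -mulrA -expRD.
have -> : - decay * boundary + decay * y = decay * (y - boundary) by ring.
by rewrite /scale {3}/boundary; field; rewrite h1 h3.
Qed.

Lemma continuation_value_candidate (y : R) :
  continuation_value alpha nu decay (scale * expR (- decay * boundary)) y =
  y / alpha + nu / alpha ^+ 2 + scale * expR (decay * (y - boundary)).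
Proof.
rewrite /continuation_value -mulrA -expRD; congr (_ + _ * expR _); ring.
Qed.

End free_boundary.

Theorem proposition1 (R : realType) (d : measure_display)
    (Omega : measurableType d) (P : probability Omega R)
    (F : R -> set (set Omega)) (B : R -> Omega -> R)
    (alpha sigma nu : R)
    (hF : is_filtration F) (hB : is_brownian_motion P F B)
    (halpha : 0 < alpha) (hsigma : 0 < sigma) :
  let X : R -> R -> Omega -> R := drifted_brownian_motion nu sigma B in
  let V : R -> \bar R := fun x => optimal_return alpha P F (X x) in
  let r : R := Num.sqrt (nu ^+ 2 + 2 * alpha * sigma ^+ 2) in
  let xi : R := - (nu / alpha) - sigma ^+ 2 / (nu + r) in
  [/\ xi = sigma ^+ 2 / (nu - r) /\ xi < 0,
      forall x : R, exists2 tau, stopping_times F tau &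
        discounted_return alpha P (X x) tau = V x,
      forall x : R,
        V x = (if xi < x then
                 x / alpha + nu / alpha ^+ 2
                 + (sigma ^+ 2 / alpha) / (nu + r)
                   * expR ((- nu - r) / sigma ^+ 2 * (x - xi))
               else 0)%:E
    & forall x : R,
        V x = discounted_return alpha P (X x)
                (exit_time (X x) [set y : R | xi < y])].
Proof.
move=> X V r xi.
pose lam := decay alpha nu sigma.
pose c := scale alpha nu sigma.
pose C := c * expR (- lam * xi).
have lamE : exponent nu sigma lam = alpha by exact: exponent_decay.
have vE y : continuation_value alpha nu lam C y =
    c * (expR (lam * (y - xi)) - 1 - lam * (y - xi)).
  exact: continuation_value_smooth_fit.
have c0 : 0 <= c by exact: scale_ge0.
have lam0 : lam <= 0 by exact: decay_le0.
have v_ge0 y : 0 <= continuation_value alpha nu lam C y.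
  exact: (continuation_value_ge0 c0 vE).
have v_xi : continuation_value alpha nu lam C xi = 0.
  exact: (continuation_value_boundary vE).
have upper x tau : optional_time F tau ->
    (discounted_return alpha P (X x) tau <= (continuation_value alpha nu lam C x)%:E)%E.
  move=> otau; rewrite (optional_returnE hF hB nu sigma halpha x otau) lee_fin.
  exact: (area_le_continuation_value hF hB halpha lamE x otau).
have upper0 x tau : x <= xi -> optional_time F tau ->
    (discounted_return alpha P (X x) tau <= 0)%E.
  move=> xxi otau; apply: le_trans (discounted_return_mono hF hB nu sigma halpha otau xxi) _.
  by rewrite -[leRHS]/(0%:E) -v_xi; exact: upper.
pose value x : R := if xi < x then continuation_value alpha nu lam C x else 0.
(* From [x >= xi] the entrance rule is optimal whichever of its two versions is
   taken. *)
have attain x (Q : set R) : xi <= x -> (forall t, Q t -> 0 <= t) ->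
    (forall t, 0 < t -> Q t) -> optional_time F (entrance_time B nu sigma x xi Q) ->
    discounted_return alpha P (X x) (entrance_time B nu sigma x xi Q) =
    (continuation_value alpha nu lam C x)%:E.
  move=> xix Q0 Q1 oQ; apply/eqP; rewrite eq_le upper//=.
  rewrite (optional_returnE hF hB nu sigma halpha x oQ) lee_fin.
  apply: (continuation_value_le_area hF hB halpha lamE oQ c0 lam0 vE).
    by move=> w t; exact: (entrance_time_stay hB Q1 xix).
  by move=> w t; exact: (entrance_time_exit hB Q0 Q1 xix).
have bound x tau : stopping_times F tau ->
    (discounted_return alpha P (X x) tau <= (value x)%:E)%E.
  move=> /(stopping_time_optional hF) otau; rewrite /value.
  by case: ltP => [_|xxi]; [exact: upper|exact: upper0].
have best x : exists2 tau, stopping_times F tau &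
    discounted_return alpha P (X x) tau = (value x)%:E.
  rewrite /value; case: ltP => xxi.
    (* Admitting the time zero makes the rule a genuine stopping time. *)
    exists (entrance_time B nu sigma x xi [set t | 0 <= t]).
      exact: (hitting_time_stopping hF hB).
    apply: attain => //; first exact: ltW.
      by move=> t /ltW.
    by apply: (stopping_time_optional hF); exact: (hitting_time_stopping hF hB).
  have st0 : stopping_times F (fun=> 0%E).
    split => // t t0; rewrite -(past_measurableE hF _ t0) (_ : [set w | _] = setT)//.
    by apply/seteqP; split => // w _; rewrite /= lee_fin.
  exists (fun=> 0%E) => //.
  by apply: (immediate_return hF hB nu sigma halpha x) => //; exact: stopping_time_optional.
have VE x : V x = (value x)%:E.
  apply/eqP; rewrite eq_le; apply/andP; split.
    by apply: ge_ereal_sup => _ [tau stau <-]; exact: bound.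
  by have [tau stau <-] := best x; apply: ereal_sup_ubound; exists tau.
split.
- by split; [exact: boundaryE|exact: boundary_lt0].
- by move=> x; have [tau stau e] := best x; exists tau => //; rewrite VE.
- move=> x; rewrite VE /value; case: ifPn => // _; congr (_%:E).
  exact: continuation_value_candidate.
- move=> x; rewrite VE (exit_time_entrance B nu sigma x xi).
  have oE := entrance_time_optional hF hB nu sigma x xi.
  have [xix|xxi] := leP xi x.
    rewrite attain//; last by move=> t /ltW.
    rewrite /value; case: ltP => // xxi; congr (_%:E).
    by have -> : x = xi by apply/eqP; rewrite eq_le xxi xix.
  rewrite /value ltNge (ltW xxi)/=; apply/esym.
  apply: (immediate_return hF hB nu sigma halpha x oE) => w B0.
  exact: (entrance_time_immediate hB nu sigma xxi B0).
Qed.
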